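(* Let $k\ge3$, let $s\ge0$ be an integer, and let $\mathbf F$ be a satisfiable $(\le k)$-CNF formula. Then $p_{\mathrm{success}}(\mathbf F,s)\ge 2^{-c(\mathbf F)}$.
   Context: A literal is a variable $x$ or its negation $\bar x$; a clause is a finite set of literals over pairwise distinct variables; a CNF formula $\mathbf F=(F,V)$ has variable set $V(\mathbf F)=V$ (finite), $n(\mathbf F)=|V|$, and a finite set $F$ of clauses over $V$; it is $(\le k)$-CNF if all clauses have at most $k$ literals. Assignments on $V$ are maps $V\to\{0,1\}$, identified with the set of literals they satisfy; $\mathrm{sat}(\mathbf F)$ is the set of satisfying assignments on $V(\mathbf F)$. For a literal $l$ over $y\in V(\mathbf F)$, $\mathbf F^{[l]}$ deletes clauses containing $l$, deletes $\bar l$ from clauses, and removes $y$ from the variable set. A literal $l$ over $V(\mathbf F)$ is $s$-implied by $\mathbf F$ if there is $G\subseteq F$ with $|G|\le s$ such that every assignment on $V$ satisfying all clauses of $G$ satisfies $l$. $\mathrm{PPSZ}(\mathbf F,\beta,\pi,s)$, for an assignment $\beta$ and a permutation $\pi$ of $V(\mathbf F)$: start with an empty partial assignment; for each variable $x$ in the order $\pi$: (i) while the current formula has an $s$-implied literal $l$, restrict the current formula to $l$ and record $l$; (ii) then, if $x$ is still a variable of the current formula, restrict it by $x\mapsto\beta(x)$ and record this; $x$ is then called guessed. Output the recorded assignment. $p_{\mathrm{success}}(\mathbf F,s)$ is the probability, with $\beta$ uniform over assignments on $V(\mathbf F)$ and $\pi$ an independent uniform permutation, that $\mathrm{PPSZ}(\mathbf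 F,\beta,\pi,s)\in\mathrm{sat}(\mathbf F)$. For $\alpha\in\mathrm{sat}(\mathbf F)$, $p_{\mathrm{guessed}}(\mathbf F,x,\alpha,s)$ is the probability over uniform $\pi$ that $x$ is guessed in $\mathrm{PPSZ}(\mathbf F,\alpha,\pi,s)$ ($0$ if $x\notin V(\mathbf F)$). A variable $x\in V(\mathbf F)$ is frozen if all satisfying assignments of $\mathbf F$ agree on $x$, non-frozen otherwise. $\mathrm{SL}(\mathbf F)$ is the set of literals $l$ over $V(\mathbf F)$ with $\mathbf F^{[l]}$ satisfiable. AssignSatisfiableLiterals$(\mathbf F)$: start with the empty assignment; while $V(\mathbf F)\neq\emptyset$, choose $l$ uniformly at random from $\mathrm{SL}(\mathbf F)$, add it, and set $\mathbf F\leftarrow\mathbf F^{[l]}$; output the assignment. $p(\mathbf F,\alpha)$ is the probability that it outputs $\alpha$. Cost: let $S_k:=\int_0^1\frac{t^{1/(k-1)}-t}{1-t}\,dt$ and let $S$ be a real number with $S\ge S_k$ such that $p_{\mathrm{guessed}}(\mathbf F',x,\alpha,s)\le S$ for every satisfiable $(\le k)$-CNF $\mathbf F'$, every frozen $x$ of $\mathbf F'$ and every $\alpha\in\mathrm{sat}(\mathbf F')$. Define $c(\mathbf F,x)=0$ if $x\notin V(\mathbf F)$; $c(\mathbf F,x)=S$ if $x$ is non-frozen; $c(\mathbf F,x)=\sum_{\alpha\in\mathrm{sat}(\mathbf F)}p(\mathbf F,\alpha)\,p_{\mathrm{guessed}}(\mathbf F,x,\alpha,s)$ if $x$ is frozen;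 and $c(\mathbf F):=\sum_{x\in V(\mathbf F)}c(\mathbf F,x)$. *)

(* Defs.v *)
From mathcomp Require Import all_boot all_order all_algebra all_fingroup.
From mathcomp Require Import finmap.
From mathcomp Require Import all_classical all_reals all_analysis.

Set Implicit Arguments.
Unset Strict Implicit.
Unset Printing Implicit Defensive.

Import Order.TTheory GRing.Theory Num.Theory.

Local Open Scope fset_scope.
Local Open Scope ring_scope.

(* Variables are natural numbers.  The literal (x, b) is satisfied exactly when
   x is mapped to b: (x, true) is the variable x, (x, false) its negation. *)
Definition lit : choiceType := (nat * bool)%type.
Definition clause : choiceType := {fset lit}.

Definition neg (l : lit) : lit := (l.1, ~~ l.2).

Record cnf := CNF { clauses : {fset clause}; vars : {fset nat} }.

Definition wf_cnf (F : cnf) : Prop :=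
  forall C : clause, C \in clauses F ->
    (forall l : lit, l \in C -> l.1 \in vars F) /\ {in C &, injective fst}.

Definition le_cnf (k : nat) (F : cnf) : Prop :=
  wf_cnf F /\ (forall C : clause, C \in clauses F -> (#|` C| <= k)%N).

Definition lits_over (V : {fset nat}) : {fset lit} :=
  V `*` [fset true; false].

Definition assignment (V : {fset nat}) : finType := {ffun V -> bool}.

(* The identification of an assignment with the set of literals it satisfies. *)
Definition lits_of (V : {fset nat}) (a : assignment V) : {fset lit} :=
  [fset ((val x, a x) : lit) | x : V].

Definition sat_clause (V : {fset nat}) (a : assignment V) (C : clause) : bool :=
  C `&` lits_of a != fset0.

Definition sat_clauses (V : {fset nat}) (a : assignment V)
    (G : {fset clause}) : bool :=
  all (sat_clause a) G.

Definition sat (F : cnf) : {set assignment (vars F)} :=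
  [set a : assignment (vars F) | sat_clauses a (clauses F)].

Definition satisfiable (F : cnf) : bool :=
  [exists a : assignment (vars F), a \in sat F].

(* F^[l]; [neg l] is removed from the clauses that do not contain [l]. *)
Definition restrict_cnf (F : cnf) (l : lit) : cnf :=
  CNF [fset ((C `\ neg l) : clause) | C in clauses F & l \notin C]
      (vars F `\ l.1).

Definition implied (s : nat) (F : cnf) (l : lit) : bool :=
  (l.1 \in vars F) &&
  has (fun G : {fset clause} => (#|` G| <= s)%N &&
         [forall a : assignment (vars F), sat_clauses a G ==> (l \in lits_of a)])
      (fpowerset (clauses F)).

(* The loop "while there is an s-implied literal l" does not say which l is
   processed first.  The choice is made by a rule [sel], which may be any
   function returning an s-implied literal whenever there is one. *)
Definition selection_rule (s : nat) (sel : cnf -> option lit) : Prop :=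
  forall F : cnf,
    if sel F is Some l then (implied s F l : Prop)
    else forall l : lit, ~~ implied s F l.

Record ppsz_state := PPSZState {
  current : cnf; recorded : {fset lit}; guessed : {fset nat} }.

(* Each round removes a variable, so that [n] rounds complete the loop
   as soon as [n] is at least the number of variables. *)
Fixpoint propagate (sel : cnf -> option lit) (n : nat) (st : ppsz_state) :
    ppsz_state :=
  if n is n'.+1 then
    if sel (current st) is Some l then
      propagate sel n'
        (PPSZState (restrict_cnf (current st) l) (l |` recorded st) (guessed st))
    else st
  else st.

Definition ppsz_step (sel : cnf -> option lit) (V : {fset nat})
    (beta : assignment V) (st : ppsz_state) (x : V) : ppsz_state :=
  let st' := propagate sel #|` vars (current st)| st in
  if val x \in vars (current st') then
    let l : lit := (val x, beta x) in
    PPSZState (restrict_cnf (current st') l) (l |` recorded st')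
              (val x |` guessed st')
  else st'.

(* The permutation [pi] is read as the order pi(x0), pi(x1), ... where
   x0, x1, ... is the fixed enumeration of the variables. *)
Definition ppsz_run (sel : cnf -> option lit) (F : cnf)
    (beta : assignment (vars F)) (pi : {perm vars F}) : ppsz_state :=
  foldl (ppsz_step sel beta) (PPSZState F fset0 fset0) (codom pi).

Definition ppsz (sel : cnf -> option lit) (F : cnf)
    (beta : assignment (vars F)) (pi : {perm vars F}) : {fset lit} :=
  recorded (ppsz_run sel beta pi).

Definition unif_prob (R : realType) (T : finType) (P : pred T) : R :=
  #|P|%:R / #|T|%:R.

Definition p_success (R : realType) (sel : cnf -> option lit) (F : cnf) : R :=
  @unif_prob R (assignment (vars F) * {perm vars F})%type
    (fun w => [exists a in sat F, ppsz sel w.1 w.2 == lits_of a]).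

Definition p_guessed (R : realType) (sel : cnf -> option lit) (F : cnf)
    (x : nat) (alpha : assignment (vars F)) : R :=
  @unif_prob R {perm vars F}
    (fun pi => x \in guessed (ppsz_run sel alpha pi)).

Definition SL (F : cnf) : {fset lit} :=
  [fset l in lits_over (vars F) | satisfiable (restrict_cnf F l)].

(* The probability that the procedure outputs [out], when started on [F] with
   the literals of [acc] already added; [n] is the number of variables of [F]. *)
Fixpoint asl (R : realType) (n : nat) (F : cnf) (acc out : {fset lit}) : R :=
  if n is n'.+1 then
    \sum_(l <- SL F) (#|` SL F|%:R)^-1 * asl R n' (restrict_cnf F l) (l |` acc) out
  else (acc == out)%:R.

Definition p_asl (R : realType) (F : cnf) (alpha : assignment (vars F)) : R :=
  asl R #|` vars F| F fset0 (lits_of alpha).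

Definition frozen (F : cnf) (x : vars F) : bool :=
  [forall a in sat F, forall b in sat F, a x == b x].

(* At t = 1 the integrand is 0 / 0 = 0, which does not affect the integral. *)
Definition S_int (R : realType) (k : nat) : R :=
  (\int[lebesgue_measure]_(t in `[0%R, 1%R]%classic)
     ((t `^ (k%:R - 1)^-1 - t) / (1 - t)))%R.

Definition var_cost (R : realType) (sel : cnf -> option lit) (S : R)
    (F : cnf) (x : nat) : R :=
  if insub x is Some y then
    if frozen (y : vars F) then
      \sum_(alpha in sat F) p_asl R alpha * p_guessed R sel x alpha
    else S
  else 0.

Definition cost (R : realType) (sel : cnf -> option lit) (S : R) (F : cnf) : R :=
  \sum_(x <- vars F) var_cost sel S F x.

(* Main.v *)
Require Import Defs.
From mathcomp Require Import all_boot all_order all_algebra all_fingroup.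
From mathcomp Require Import finmap ring lra.
From mathcomp Require Import all_classical all_reals all_analysis measurable_realfun.

(* Everything is computed with total assignments [nat -> bool]: for a satisfying
   assignment [A], propagation turns [F] into [F] restricted by [A] on the least
   set of variables that leaves nothing implied, so the order of propagation is
   irrelevant and restricting [F] further can only make fewer variables guessed.

   The bound is proved by induction on the number of variables.  If a literal
   [l] is implied, the first step is [F -> F^[l]], which keeps the success
   probability and does not increase the cost.  Otherwise, with n variables, M of
   them non-frozen, |SL F| = n + M and the success probability of F is at least
   the sum over l in SL F of those of the F^[l], divided by 2n.  The costs c_l of
   the F^[l] satisfy
     sum_l c_l <= |SL F| c - n - M (2 S - 1);
   a frozen x contributes -1 because the sum over y of
   p_guessed(F, x) - p_guessed(F^[y = a(y)], x) is 1 and each term, being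
   nonnegative, has a weight p(F^[y = a(y)], a) that is at least p(F, a).
   The tangent 2^d >= 2 (1 + (d - 1) ln 2) at d = 1, taken at d = c - c_l, reduces
   the claim to 2 ln 2 (1 - S) <= 1, which follows from S_k >= 7/24. *)

Set Implicit Arguments.
Unset Strict Implicit.
Unset Printing Implicit Defensive.

Import Order.TTheory GRing.Theory Num.Theory.

Local Open Scope fset_scope.
Local Open Scope ring_scope.

(** * Restriction by a total assignment *)

Definition satc (A : nat -> bool) (C : clause) : bool :=
  [exists l : C, A (val l).1 == (val l).2].

Definition satf (A : nat -> bool) (F : cnf) : bool :=
  [forall C : clauses F, satc A (val C)].

Lemma satcP A (C : clause) :
  reflect (exists2 l : lit, l \in C & A l.1 = l.2) (satc A C).
Proof.
apply: (iffP existsP) => [[l /eqP h]|[l lC h]]; first by exists (val l) => //; exact: valP.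
by exists [` lC]; rewrite /= h.
Qed.

Lemma satfP A F :
  reflect (forall C : clause, C \in clauses F -> satc A C) (satf A F).
Proof.
apply: (iffP forallP) => [h C CF|h C]; first exact: (h [` CF]).
exact: h (valP C).
Qed.

Definition unsatisfied_on (A : nat -> bool) (W : {fset nat}) (C : clause) : bool :=
  [forall l : C, ((val l).1 \in W) ==> (A (val l).1 != (val l).2)].

Definition clause_off (W : {fset nat}) (C : clause) : clause :=
  [fset l in C | l.1 \notin W].

(** Restriction by the literals [(x, A x)], [x] in [W], all at once; a set of variables carries no
    order of processing. *)
Definition restrict_on (A : nat -> bool) (W : {fset nat}) (F : cnf) : cnf :=
  CNF [fset clause_off W C | C in clauses F & unsatisfied_on A W C] (vars F `\` W).

Lemma missedP A W (C : clause) :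
  reflect (forall l : lit, l \in C -> l.1 \in W -> A l.1 != l.2) (unsatisfied_on A W C).
Proof.
apply: (iffP forallP) => h l; first by move=> lC lW; have /implyP := h [` lC]; apply.
by apply/implyP; apply: h; exact: valP.
Qed.

Lemma res_clausesP A W F (C' : clause) :
  reflect (exists2 C : clause, C \in clauses F &
    (forall l : lit, l \in C -> l.1 \in W -> A l.1 != l.2) /\ C' = clause_off W C)
    (C' \in clauses (restrict_on A W F)).
Proof.
apply: (iffP (imfsetP _ _ _ _)) => /= [[C]|[C CF [h ->]]].
  by rewrite inE /= => /andP[CF /missedP h] ->; exists C.
by exists C => //; rewrite inE /= CF /=; apply/missedP.
Qed.

Lemma cnf_eq F G : vars F = vars G -> clauses F =i clauses G -> F = G.
Proof. by case: F G => [c v] [c' v'] /= -> /fsetP ->. Qed.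

Lemma res0 A F : restrict_on A fset0 F = F.
Proof.
have e (C : clause) : clause_off fset0 C = C.
  by apply/fsetP => l; rewrite !inE /= andbT.
apply: cnf_eq => [|C]; first by rewrite /= fsetD0.
apply/res_clausesP/idP => [[D DF [_ ->]]|CF]; first by rewrite e.
by exists C => //; split=> //; rewrite e.
Qed.

(** A clause survives both restrictions exactly when [A] falsifies all its literals over [W] and
    over [Z]. *)
Lemma resU A W Z F : restrict_on A Z (restrict_on A W F) = restrict_on A (W `|` Z) F.
Proof.
apply: cnf_eq => [|C]; first by rewrite /= fsetDDl.
apply/res_clausesP/res_clausesP => [[D /res_clausesP[E EF [hE ->]] [hD ->]]|].
  exists E => //; split => [l lE|].
    rewrite inE; case: (boolP (l.1 \in W)) => /= lW; first by move=> _; exact: hE.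
    by apply: hD; rewrite !inE /= lE.
  by apply/fsetP => l; rewrite !inE /= negb_or andbA.
case=> E EF [hE ->]; exists (clause_off W E).
  by apply/res_clausesP; exists E => //; split=> // l lE lW; apply: hE; rewrite // inE lW.
split=> [l|]; last by apply/fsetP => l; rewrite !inE /= negb_or andbA.
by rewrite !inE /= => /andP[lE lW] lZ; apply: hE; rewrite // inE lZ orbT.
Qed.

(** A surviving clause does not contain [l], so [neg l] is its only possible literal over that
    variable; deleting it is deleting all literals over the variable. *)
Lemma res_restrict A F (l : lit) : A l.1 = l.2 -> restrict_cnf F l = restrict_on A [fset l.1] F.
Proof.
move=> Al; have el (C : clause) : l \notin C ->
    C `\ neg l = clause_off [fset l.1] C.
  move=> lC; apply/fsetP => m; rewrite !inE /= andbC; case: (boolP (m \in C)) => //= mC.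
  congr negb; apply/eqP/eqP => [->//|e]; case: m mC e => a b /= mC e.
  rewrite e in mC *; case: l Al lC mC {e} => c d /= Al lC mC; rewrite /neg /=.
  by congr pair; apply/eqP; case: b d lC mC {Al} => -[] // /negP.
apply: cnf_eq => // C; apply/imfsetP/res_clausesP => /=.
  case=> D; rewrite inE /= => /andP[DF lD] ->; exists D => //; split; last exact: el.
  move=> m mD; rewrite inE => /eqP e; apply/negP; rewrite e Al => /eqP e2.
  by move: mD; rewrite [m]surjective_pairing e -e2 -surjective_pairing (negPf lD).
case=> D DF [h ->]; exists D; rewrite ?inE /=; last rewrite el //.
  rewrite DF /=; apply/negP => /h; rewrite inE => /(_ (eqxx _)).
  by rewrite Al eqxx.
by apply/negP => /h; rewrite inE => /(_ (eqxx _)); rewrite Al eqxx.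
Qed.

Lemma wf_res A W F : wf_cnf F -> wf_cnf (restrict_on A W F).
Proof.
move=> wF C /res_clausesP[D DF [_ ->]]; have [h1 h2] := wF D DF; split.
  by move=> l; rewrite !inE /= => /andP[lD ->]; rewrite h1.
by move=> l m; rewrite !inE /= => /andP[lD _] /andP[mD _]; exact: h2.
Qed.

Lemma res_notin A W F : wf_cnf F -> [disjoint vars F & W] -> restrict_on A W F = F.
Proof.
move=> wF dW; have e (C : clause) : C \in clauses F -> clause_off W C = C.
  move=> CF; apply/fsetP => l; rewrite !inE /= andb_idr // => lC.
  by apply: (fdisjointP dW); exact: (wF C CF).1.
apply: cnf_eq => [|C]; first by rewrite /=; apply/fsetDidPl.
apply/res_clausesP/idP => [[D DF [_ ->]]|CF]; first by rewrite e.
exists C => //; split=> [l lC lW|]; last by rewrite e.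
by have := fdisjointP dW _ ((wF C CF).1 l lC); rewrite lW.
Qed.

Lemma satf_res A W F : satf A F -> satf A (restrict_on A W F).
Proof.
move/satfP => h; apply/satfP => _ /res_clausesP[C CF [hC ->]].
have /satcP[l lC Al] := h C CF; apply/satcP; exists l => //; rewrite !inE /= lC.
by apply/negP => /(hC l lC); rewrite Al eqxx.
Qed.

(** A dropped clause is satisfied inside [W], where [A] and [B] agree; a kept clause is satisfied by
    a literal outside [W]. *)
Lemma res_satf A B W F : {in W, A =1 B} -> satf A (restrict_on B W F) -> satf A F.
Proof.
move=> AB /satfP h; apply/satfP => C CF; apply/satcP.
case: (pselect (exists2 l, l \in C & l.1 \in W /\ A l.1 = l.2)) => [[l lC []]|hn].
  by exists l.
have /satcP[l] : satc A (clause_off W C).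
  apply: h; apply/res_clausesP; exists C => //; split=> // l lC lW.
  by apply/eqP => e; case: hn; exists l => //; rewrite AB.
by rewrite !inE /= => /andP[lC _]; exists l.
Qed.

Lemma eq_restrict_on A B W F : {in W, A =1 B} -> restrict_on A W F = restrict_on B W F.
Proof.
move=> AB; apply: cnf_eq => // C.
by apply/res_clausesP/res_clausesP => -[D DF [h ->]]; exists D => //; split=> // l lD lW;
  move: (h l lD lW); rewrite AB.
Qed.

Lemma eq_satc A B F (C : clause) : wf_cnf F -> C \in clauses F ->
  {in vars F, A =1 B} -> satc A C = satc B C.
Proof.
move=> wF CF AB; apply/satcP/satcP => -[l lC h]; exists l => //.
  by rewrite -AB //; exact: (wF C CF).1.
by rewrite AB //; exact: (wF C CF).1.
Qed.

Lemma eq_satf A B F : wf_cnf F -> {in vars F, A =1 B} -> satf A F = satf B F.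
Proof.
move=> wF AB; apply/satfP/satfP => h C CF; have := h C CF;
  by rewrite (eq_satc wF CF AB).
Qed.

(** Assignments on different variable sets have different types; a total function serves [F] and all
    its restrictions. The default value outside [V] is [false]. *)
Definition total_of (V : {fset nat}) (a : assignment V) : nat -> bool :=
  fun x => if insub x is Some y then a y else false.

Lemma extE V (a : assignment V) (y : V) : total_of a (val y) = a y.
Proof. by rewrite /total_of valK. Qed.

Lemma ext_in V (a : assignment V) x (xV : x \in V) : total_of a x = a [` xV].
Proof. by rewrite -[x]/(val [` xV]) extE. Qed.

Lemma lits_ofP V (a : assignment V) (l : lit) :
  (l \in lits_of a) = (l.1 \in V) && (total_of a l.1 == l.2).
Proof.
apply/imfsetP/andP => /= [[x _ ->] /=|[lV /eqP e]]; first by rewrite extE (valP x).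
exists [` lV] => //=; rewrite -ext_in e; exact: surjective_pairing.
Qed.

Lemma sat_clauseE F (a : assignment (vars F)) (C : clause) :
  wf_cnf F -> C \in clauses F -> sat_clause a C = satc (total_of a) C.
Proof.
move=> wF CF; apply/fset0Pn/satcP => [[l]|[l lC e]].
  by rewrite inE lits_ofP => /and3P[lC _ /eqP e]; exists l.
exists l; rewrite inE lC lits_ofP e eqxx andbT; exact: (wF C CF).1.
Qed.

Lemma in_satE F (a : assignment (vars F)) : wf_cnf F -> (a \in sat F) = satf (total_of a) F.
Proof.
move=> wF; rewrite inE; apply/allP/satfP => h C CF; have := h C CF;
  by rewrite (sat_clauseE _ wF).
Qed.

Definition assignment_of (V : {fset nat}) (A : nat -> bool) : assignment V :=
  [ffun y => A (val y)].

Lemma ext_inj V A : {in V, total_of (assignment_of V A) =1 A}.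
Proof. by move=> x xV; rewrite (ext_in _ xV) ffunE. Qed.

Lemma satisfiableP F : wf_cnf F -> reflect (exists A, satf A F) (satisfiable F).
Proof.
move=> wF; apply: (iffP existsP) => [[a]|[A sA]].
  by rewrite in_satE // => h; exists (total_of a).
exists (assignment_of (vars F) A); rewrite in_satE // (@eq_satf _ A) //.
exact: ext_inj.
Qed.

(** Total assignments may replace those on [vars F], because the clauses of [G] mention only
    variables of [F]. *)
Lemma impliedP s F l : wf_cnf F -> reflect (l.1 \in vars F /\
  exists G : {fset clause}, [/\ G `<=` clauses F, (#|` G| <= s)%N &
    forall A : nat -> bool, (forall C, C \in G -> satc A C) -> A l.1 = l.2])
  (implied s F l).
Proof.
move=> wF; apply: (iffP andP) => -[lF].
  case/hasP => G; rewrite fpowersetE => GF /andP[sG /forallP h]; split=> //.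
  exists G; split=> // A hA; have /implyP h1 := h (assignment_of (vars F) A).
  have /h1 : sat_clauses (assignment_of (vars F) A) G.
    apply/allP => C CG; have CF := fsubsetP GF _ CG.
    rewrite (sat_clauseE _ wF CF) (eq_satc wF CF (B := A)); first exact: hA.
    exact: ext_inj.
  by rewrite lits_ofP lF => /eqP <-; rewrite ext_inj.
case=> G [GF sG h]; split=> //; apply/hasP; exists G; rewrite ?fpowersetE // sG /=.
apply/forallP => a; apply/implyP => /allP ha; rewrite lits_ofP lF /=; apply/eqP.
by apply: h => C CG; rewrite -(sat_clauseE a wF) ?ha //; exact: (fsubsetP GF).
Qed.

Lemma implied_sat s F l A : wf_cnf F -> implied s F l -> satf A F -> A l.1 = l.2.
Proof.
move=> wF /(impliedP _ _ wF)[_ [G [GF _ h]]] /satfP sA; apply: h => C CG.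
by apply: sA; exact: (fsubsetP GF).
Qed.

(** The witness [G], restricted along with [F], is again a witness: it has no more clauses than
    before, and it still forces [l], whose variable is outside [Z]. *)
Lemma implied_res s F l A Z : wf_cnf F -> implied s F l -> l.1 \notin Z ->
  implied s (restrict_on A Z F) l.
Proof.
move=> wF /(impliedP _ _ wF)[lF [G [GF sG h]]] lZ; apply/impliedP; first exact: wf_res.
split; first by rewrite /= inE lZ.
exists (clauses (restrict_on A Z (CNF G (vars F)))); split.
- apply/fsubsetP => C /res_clausesP[D DG [hD ->]]; apply/res_clausesP; exists D => //.
  exact: (fsubsetP GF).
- apply: leq_trans sG; rewrite /=.
  apply: leq_trans (leq_imfset_card _ _ _) _.
  apply: leq_trans (_ : #|` [fset C in G | unsatisfied_on A Z C]| <= _)%N.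
    by apply: uniq_leq_size (enum_finmem_uniq _) _ => C; rewrite enum_finmemE !inE.
  by apply: fsubset_leq_card; apply/fsubsetP => C; rewrite !inE /= => /andP[].
(* [B'] follows [A] on [Z] and [B] elsewhere; it satisfies [G] as soon as [B] satisfies the
   restriction of [G]. *)
- move=> B hB; pose B' x := if x \in Z then A x else B x.
  suff: B' l.1 = l.2 by rewrite /B' (negPf lZ).
  apply: h; suff /satfP : satf B' (CNF G (vars F)) by [].
  apply: (@res_satf _ A Z) => [x xZ|].
    by rewrite /B' xZ.
  apply/satfP => C CG; have /satcP[m mC e] := hB C CG; apply/satcP; exists m => //.
  have /res_clausesP[D _ [_ eC]] := CG; move: mC; rewrite eC !inE /= => /andP[_ mZ].
  by rewrite /B' (negPf mZ).
Qed.

(** * Propagation and guessing along an order *)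

Definition assign_cnf (a : nat -> bool) (F : cnf) (z : nat) : cnf :=
  if z \in vars F then restrict_cnf F (z, a z) else F.

Lemma wf_restrict F (l : lit) : wf_cnf F -> wf_cnf (restrict_cnf F l).
Proof. by move=> wF; rewrite (@res_restrict (fun=> l.2)) //; exact: wf_res. Qed.

Lemma stp_res a F z : wf_cnf F -> assign_cnf a F z = restrict_on a [fset z] F.
Proof.
move=> wF; rewrite /assign_cnf; case: ifPn => [zF|zF]; first exact: (@res_restrict a F (z, a z)).
by rewrite res_notin // fdisjointX1.
Qed.

Lemma vars_stp a F z : vars (assign_cnf a F z) = vars F `\ z.
Proof.
by rewrite /assign_cnf; case: ifPn => // zF; apply/esym/fsetDidPl; rewrite fdisjointX1.
Qed.

Fixpoint closure_upto (sel : cnf -> option lit) n (F : cnf) : cnf :=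
  if n is n'.+1 then
    if sel F is Some l then closure_upto sel n' (restrict_cnf F l) else F
  else F.

Definition closure_cnf sel F := closure_upto sel #|` vars F| F.

Lemma current_propagate sel n st :
  current (propagate sel n st) = closure_upto sel n (current st).
Proof. by elim: n st => //= n IH st; case: (sel _) => [l|] //=; rewrite IH. Qed.

(* The last propagation is not part of the run; it makes [final_cnf] invariant
   under propagation of its argument and is void once no variable is left. *)
Definition final_cnf sel (a : nat -> bool) (F : cnf) (t : seq nat) : cnf :=
  closure_cnf sel (foldl (fun G z => assign_cnf a (closure_cnf sel G) z) F t).

Fixpoint is_guessed sel (a : nat -> bool) (x : nat) (F : cnf) (t : seq nat) : bool :=
  if t is z :: t' then
    (x == z) && (x \in vars (closure_cnf sel F)) || is_guessed sel a x (assign_cnf a (closure_cnf sel F) z) t'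
  else false.

Lemma sel_in s sel F l : selection_rule s sel -> sel F = Some l -> l.1 \in vars F.
Proof. by move=> hs e; have := hs F; rewrite e => /andP[]. Qed.

Lemma card_restrict F (l : lit) : l.1 \in vars F ->
  #|` vars F| = #|` vars (restrict_cnf F l)|.+1.
Proof. by move=> lF; rewrite /= (cardfsD1 l.1) lF. Qed.

Lemma closure_Some s sel F l : selection_rule s sel -> sel F = Some l ->
  closure_cnf sel F = closure_cnf sel (restrict_cnf F l).
Proof.
by move=> hs e; rewrite /closure_cnf (@card_restrict F l (sel_in hs e)) /= e.
Qed.

Lemma closure_None sel F : sel F = None -> closure_cnf sel F = F.
Proof. by rewrite /closure_cnf; case: #|` _| => //= n ->. Qed.

(** Propagation can serve as an induction, since every round removes a variable. *)
Lemma closure_ind s sel (P : cnf -> Prop) : selection_rule s sel ->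
  (forall F, sel F = None -> P F) ->
  (forall F l, sel F = Some l -> P (restrict_cnf F l) -> P F) -> forall F, P F.
Proof.
move=> hs h0 h1 F; have [n] := ubnP #|` vars F|; elim: n F => // n IH F.
case e: (sel F) => [l|]; last by move=> _; exact: h0.
rewrite (@card_restrict F l (sel_in hs e)) ltnS => h; apply: (h1 F l e).
exact: IH.
Qed.

Lemma sel_closure s sel F : selection_rule s sel -> sel (closure_cnf sel F) = None.
Proof.
move=> hs; have ind P := @closure_ind s sel P hs; elim/ind: F => [F e|F l e IH].
  by rewrite closure_None.
by rewrite (closure_Some hs e).
Qed.

Lemma closure_closure s sel F : selection_rule s sel ->
  closure_cnf sel (closure_cnf sel F) = closure_cnf sel F.
Proof. by move=> hs; rewrite closure_None //; exact: sel_closure hs. Qed.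

Lemma wf_closure s sel F : selection_rule s sel -> wf_cnf F -> wf_cnf (closure_cnf sel F).
Proof.
move=> hs; have ind P := @closure_ind s sel P hs; elim/ind: F => [F e|F l e IH] wF.
  by rewrite closure_None.
by rewrite (closure_Some hs e); apply: IH; exact: wf_restrict.
Qed.

Lemma vars_closure s sel F : selection_rule s sel -> vars (closure_cnf sel F) `<=` vars F.
Proof.
move=> hs; have ind P := @closure_ind s sel P hs; elim/ind: F => [F e|F l e IH].
  by rewrite closure_None.
by rewrite (closure_Some hs e) (fsubset_trans IH) //= fsubsetDl.
Qed.

(** [W] is the least set whose restriction leaves nothing implied: the literal [l] chosen first
    stays implied until its variable is restricted, so every such [Z] contains that variable, and
    induction on [F^[l]] does the rest. *)
Lemma closureP s sel F A : selection_rule s sel -> wf_cnf F -> satf A F ->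
  exists W, closure_cnf sel F = restrict_on A W F /\
    forall Z, sel (restrict_on A Z F) = None -> W `<=` Z.
Proof.
move=> hs; have ind P := @closure_ind s sel P hs; elim/ind: F => [F e|F l e IH] wF sA.
  by exists fset0; rewrite res0 closure_None //; split=> // Z _; exact: fsub0set.
have iml : implied s F l by have := hs F; rewrite e.
have Al := implied_sat wF iml sA.
rewrite (closure_Some hs e); rewrite (res_restrict F Al) in IH *.
have [W [-> hW]] := IH (wf_res wF) (satf_res _ sA).
exists (l.1 |` W); rewrite resU; split=> // Z hZ.
have lZ : l.1 \in Z.
  apply/negPn/negP => /(implied_res A wF iml) im2.
  by have := hs (restrict_on A Z F); rewrite hZ => /(_ l); rewrite im2.
rewrite fsubUset fsub1set lZ /=; apply: hW.
by rewrite resU (fsetUidPr _ _ _) // fsub1set.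
Qed.

(** Let [U] be propagated after the restriction on [Z]. Nothing is implied after both, so by
    minimality the propagation set [W] of [F] lies in their union, and both sides become
    restrictions on that union. *)
Lemma closure_res s sel F A Z : selection_rule s sel -> wf_cnf F -> satf A F ->
  exists Z', closure_cnf sel (restrict_on A Z F) = restrict_on A Z' (closure_cnf sel F).
Proof.
move=> hs wF sA; have [W [eW hW]] := closureP hs wF sA.
have [U [eU _]] := closureP (A := A) hs (wf_res wF) (satf_res Z sA).
have /fsetUidPr WZU : W `<=` Z `|` U.
  by apply: hW; rewrite -resU -eU; exact: sel_closure hs.
by exists (Z `|` U); rewrite eU eW !resU WZU.
Qed.

(** Throughout the order, the current formula of the restricted run is a restriction of that of the
    run on [F], so a variable present in the former is present in the latter. *)
Lemma is_guessed_mono s sel A x F Z t : selection_rule s sel -> wf_cnf F -> satf A F ->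
  is_guessed sel A x (restrict_on A Z F) t -> is_guessed sel A x F t.
Proof.
move=> hs; elim: t F Z => //= z t IH F Z wF sA.
have [Z' ->] := closure_res Z hs wF sA.
have wc := wf_closure hs wF.
case/orP => [/andP[-> ]|].
  by rewrite /= inE => /andP[_ ->].
rewrite !stp_res ?resU //; last exact: wf_res.
rewrite fsetUC -resU => /IH ->; rewrite ?orbT //; first exact: wf_res.
by apply: satf_res; have [W [-> _]] := closureP hs wF sA; exact: satf_res.
Qed.

Lemma eq_is_guessed s sel A B x F t : selection_rule s sel -> {in vars F, A =1 B} ->
  is_guessed sel A x F t = is_guessed sel B x F t.
Proof.
move=> hs; elim: t F => //= z t IH F AB; congr orb.
have sc := fsubsetP (vars_closure F hs).
rewrite IH => [|y]; last by rewrite vars_stp inE => /andP[_ /sc]; exact: AB.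
by congr is_guessed; rewrite /assign_cnf; case: ifP => // /sc /AB ->.
Qed.

Lemma eq_final_cnf s sel A B F t : selection_rule s sel -> {in vars F, A =1 B} ->
  final_cnf sel A F t = final_cnf sel B F t.
Proof.
move=> hs; rewrite /final_cnf => AB; congr closure_cnf; elim: t F AB => //= z t IH F AB.
have sc := fsubsetP (vars_closure F hs).
rewrite IH => [|y]; last by rewrite vars_stp inE => /andP[_ /sc]; exact: AB.
by congr foldl; rewrite /assign_cnf; case: ifP => // /sc /AB ->.
Qed.

Lemma is_guessed_closure s sel A x F t : selection_rule s sel ->
  is_guessed sel A x (closure_cnf sel F) t = is_guessed sel A x F t.
Proof. by move=> hs; case: t => //= z t; rewrite (closure_closure _ hs). Qed.

Lemma final_cnf_closure s sel A F t : selection_rule s sel ->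
  final_cnf sel A (closure_cnf sel F) t = final_cnf sel A F t.
Proof. by move=> hs; case: t => [|z t]; rewrite /final_cnf /= (closure_closure _ hs). Qed.

Lemma is_guessed_notin s sel A x F t : selection_rule s sel -> x \notin vars F ->
  is_guessed sel A x F t = false.
Proof.
move=> hs; elim: t F => //= z t IH F xF.
have xc : x \notin vars (closure_cnf sel F).
  by apply: contra xF; exact: (fsubsetP (vars_closure F hs)).
by rewrite IH ?(negPf xc) ?andbF // vars_stp inE (negPf xc) andbF.
Qed.

Lemma notin_stp_closure s sel A y z F : selection_rule s sel -> y \notin vars F ->
  y \notin vars (assign_cnf A (closure_cnf sel F) z).
Proof.
move=> hs; apply: contra; rewrite vars_stp inE => /andP[_].
exact: (fsubsetP (vars_closure F hs)).
Qed.

(** The turn of an absent variable only triggers a propagation, and repeating a propagation has no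
    effect. *)
Lemma is_guessed_rem s sel A x y F t : selection_rule s sel -> y \notin vars F ->
  is_guessed sel A x F (rem y t) = is_guessed sel A x F t.
Proof.
move=> hs; elim: t F => //= z t IH F yF; case: eqP => [->|_] /=; last first.
  by rewrite IH //; exact: notin_stp_closure hs yF.
have yc : y \notin vars (closure_cnf sel F).
  by apply: contra yF; exact: (fsubsetP (vars_closure F hs)).
rewrite /assign_cnf (negPf yc) (is_guessed_closure _ _ _ _ hs); case: eqP => //= ->.
by rewrite (negPf yc).
Qed.

Lemma final_cnf_cons sel A F z t : final_cnf sel A F (z :: t) = final_cnf sel A (assign_cnf A (closure_cnf sel F) z) t.
Proof. by []. Qed.

Lemma final_cnf_rem s sel A y F t : selection_rule s sel -> y \notin vars F ->
  final_cnf sel A F (rem y t) = final_cnf sel A F t.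
Proof.
move=> hs; elim: t F => // z t IH F yF; rewrite /=; case: eqP => [->|_]; last first.
  by rewrite !final_cnf_cons IH //; exact: notin_stp_closure hs yF.
have yc : y \notin vars (closure_cnf sel F).
  by apply: contra yF; exact: (fsubsetP (vars_closure F hs)).
by rewrite final_cnf_cons /assign_cnf (negPf yc) (final_cnf_closure _ _ _ hs).
Qed.

Lemma is_guessed_Some s sel A x F l t : selection_rule s sel -> sel F = Some l ->
  is_guessed sel A x F t = is_guessed sel A x (restrict_cnf F l) (rem l.1 t).
Proof.
move=> hs e; rewrite (is_guessed_rem _ _ _ hs) /= ?inE ?eqxx //.
by rewrite -(is_guessed_closure _ _ _ _ hs) (closure_Some hs e) (is_guessed_closure _ _ _ _ hs).
Qed.

Lemma final_cnf_Some s sel A F l t : selection_rule s sel -> sel F = Some l ->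
  final_cnf sel A F t = final_cnf sel A (restrict_cnf F l) (rem l.1 t).
Proof.
move=> hs e; rewrite (final_cnf_rem _ _ hs) /= ?inE ?eqxx //.
by rewrite -(final_cnf_closure _ _ _ hs) (closure_Some hs e) (final_cnf_closure _ _ _ hs).
Qed.

Lemma is_guessed_restrict s sel A x F l t : selection_rule s sel -> wf_cnf F -> satf A F ->
  A l.1 = l.2 -> is_guessed sel A x (restrict_cnf F l) (rem l.1 t) -> is_guessed sel A x F t.
Proof.
move=> hs wF sA Al; rewrite (is_guessed_rem _ _ _ hs) /= ?inE ?eqxx //.
by rewrite (res_restrict F Al); exact: is_guessed_mono hs wF sA.
Qed.

(** * Sums over assignments and orders *)

Definition update (a : nat -> bool) (y : nat) (b : bool) : nat -> bool :=
  fun x => if x == y then b else a x.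

Lemma ext_notin (V : {fset nat}) (a : assignment V) x : x \notin V -> total_of a x = false.
Proof. by move=> xV; rewrite /total_of insubN. Qed.

Lemma ext_injK V (a : assignment V) : assignment_of V (total_of a) = a.
Proof. by apply/ffunP => y; rewrite ffunE extE. Qed.

Section AssignmentSums.
Variable R : realType.
Implicit Type H : (nat -> bool) -> R.

Definition assignment_sum (V : {fset nat}) H : R := \sum_(a : assignment V) H (total_of a).

(** An assignment on [V] amounts to a value at [y] and an assignment on the other variables. *)
Lemma assignment_sum_split (V : {fset nat}) y H : y \in V ->
  assignment_sum V H = \sum_(b : bool) assignment_sum (V `\ y) (fun a => H (update a y b)).
Proof.
move=> yV; rewrite /assignment_sum pair_big /=.
pose h (p : bool * assignment (V `\ y)) : assignment V :=
  assignment_of V (update (total_of p.2) y p.1).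
have hE p : total_of (h p) = update (total_of p.2) y p.1.
  apply/funext => x; case: (boolP (x \in V)) => xV; first by rewrite ext_inj.
  rewrite ext_notin // /update; case: eqP => [e|_]; first by rewrite e yV in xV.
  by rewrite ext_notin // inE (negPf xV) andbF.
rewrite (reindex h) /=; first by apply: eq_bigr => p _; rewrite hE.
apply: onW_bij; exists (fun a => (total_of a y, assignment_of (V `\ y) (total_of a))) => [p|a].
  rewrite hE; case: p {hE h} => b a /=; congr pair; first by rewrite /update eqxx.
  apply/ffunP => z; rewrite ffunE /update -(extE a); case: eqP => // e.
  by have := valP z; rewrite e !inE eqxx.
rewrite /h /= -[RHS]ext_injK; apply/ffunP => z; rewrite !ffunE /update.
case: eqP => [->//|/eqP zy]; rewrite ext_inj // inE (valP z) andbT inE.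
exact: zy.
Qed.

Lemma card_assignment V : #|assignment V| = (2 ^ #|` V|)%N.
Proof. by rewrite card_ffun card_bool cardfE. Qed.

Lemma assignment_sum_ind (V : {fset nat}) y H : y \in V -> (forall a b, H (update a y b) = H a) ->
  assignment_sum V H = 2 * assignment_sum (V `\ y) H.
Proof.
move=> yV h; rewrite (assignment_sum_split _ yV) big_bool /= mulr_natl mulr2n.
by congr (_ + _); apply: eq_bigr.
Qed.

Lemma assignment_sum_sum I (r : seq I) V (H : I -> (nat -> bool) -> R) :
  assignment_sum V (fun a => \sum_(i <- r) H i a) = \sum_(i <- r) assignment_sum V (H i).
Proof. exact: exchange_big. Qed.

End AssignmentSums.

Section OrderSums.
Variable R : realType.
Implicit Type f : seq nat -> R.

Definition order_sum (V : {fset nat}) f : R := \sum_(t <- permutations V) f t.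

Lemma order_sum_head (V : {fset nat}) f : V != fset0 ->
  order_sum V f = \sum_(y <- V) order_sum (V `\ y) (fun t => f (y :: t)).
Proof.
move=> V0; rewrite /order_sum (perm_big _ (permutationsE _)) /=; last first.
  by rewrite lt0n cardfs_eq0.
rewrite big_allpairs_dep /= undup_id ?fset_uniq //; apply: eq_bigr => y _.
apply: perm_big; apply: perm_permutations; apply: uniq_perm.
- exact/rem_uniq/fset_uniq.
- exact: fset_uniq.
- by move=> z; rewrite mem_rem_uniq ?fset_uniq // !inE.
Qed.

Lemma order_sum_fset0 f : order_sum fset0 f = f [::].
Proof.
by rewrite /order_sum (_ : enum_fset fset0 = [::]) ?big_seq1 //; apply/size0nil; exact: cardfs0.
Qed.

(** Deleting [y] maps the orders of [V] onto those of [V] without [y], each reached once for every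
    place where [y] can be inserted. The induction separates the first element of the order. *)
Lemma order_sum_rem (V : {fset nat}) (y : nat) f : y \in V ->
  order_sum V (fun t => f (rem y t)) = #|` V|%:R * order_sum (V `\ y) f.
Proof.
have [n] := ubnP #|` V|; elim: n V f => // n IH V f; rewrite ltnS => Vn yV.
have V0 : V != fset0 by apply/fset0Pn; exists y.
rewrite order_sum_head // (big_fsetD1 y) //= eqxx.
have -> : \sum_(z <- V `\ y) order_sum (V `\ z)
     (fun t => f (if z == y then t else z :: rem y t)) =
   \sum_(z <- V `\ y) #|` V `\ y|%:R * order_sum (V `\ y `\ z) (fun t => f (z :: t)).
  apply: eq_big_seq => z; rewrite !inE => /andP[zy zV]; rewrite (negPf zy).
  have c : #|` V `\ z| = #|` V `\ y|.
    by have := cardfsD1 z V; rewrite (cardfsD1 y V) zV yV => /eqP; rewrite eqn_add2l => /eqP ->.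
  rewrite (IH (V `\ z) (fun t => f (z :: t))) ?inE ?yV ?(eq_sym y z) ?zy //.
    by rewrite c; congr (_ * order_sum _ _); apply/fsetP => u; rewrite !inE andbCA.
  by rewrite c; rewrite (cardfsD1 y) yV in Vn.
rewrite -mulr_sumr (cardfsD1 y V) yV natrD mulrDl mul1r; congr (_ + _).
(* If [y] is alone in [V], there is no head to split off, but the factor in front is 0. *)
have [->|W0] := eqVneq (V `\ y) fset0; last by rewrite -order_sum_head.
by rewrite cardfs0 !mul0r.
Qed.

Lemma card_permT (T : finType) : #|{perm T}| = #|T| `!.
Proof.
rewrite -[#|T|]cardsT -card_perm; apply: eq_card => p; apply/esym.
by rewrite !inE; apply/fintype.subsetP => x _; rewrite inE.
Qed.

(** The orders read off from permutations are pairwise distinct, and there are as many as orders of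
    [V], so each order arises exactly once. *)
Lemma order_sum_perm (V : {fset nat}) f :
  \sum_(p : {perm V}) f (map val (codom p)) = order_sum V f.
Proof.
rewrite /order_sum -(big_map (fun p : {perm V} => map val (codom p)) xpredT f).
apply: perm_big.
set s1 := [seq _ | p <- _].
have u1 : uniq s1.
  rewrite map_inj_uniq ?index_enum_uniq // => p q /(inj_map val_inj) e.
  apply/permP => x.
  by have /eq_in_map := e; apply; rewrite mem_enum.
have sub : {subset s1 <= permutations V}.
  move=> _ /mapP[p _ ->]; rewrite mem_permutations.
  have um : uniq [seq val i | i <- codom p].
    rewrite map_inj_uniq; last exact: val_inj.
    by rewrite map_inj_uniq ?enum_uniq //; exact: perm_inj.
  have sV : {subset [seq val i | i <- codom p] <= V}.
    by move=> _ /mapP[i _ ->]; exact: valP.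
  have [|_ e] := uniq_min_size um sV; last by apply: uniq_perm => //; exact: fset_uniq.
  by rewrite size_map size_codom -cardfE.
have [|_ e] := uniq_min_size u1 sub; last first.
  by apply: uniq_perm => //; exact: permutations_uniq.
rewrite size_permutations ?fset_uniq // /s1 size_map -[index_enum _]/(Finite.enum _).
by rewrite -enumT -cardE card_permT -cardfE.
Qed.

Lemma card_perm_fset (V : {fset nat}) : #|{perm V}| = #|` V| `!.
Proof. by rewrite card_permT -cardfE. Qed.

Lemma le_osum (V : {fset nat}) f g : (forall t, f t <= g t) -> order_sum V f <= order_sum V g.
Proof. by move=> h; apply: ler_sum. Qed.

Lemma eq_order_sum (V : {fset nat}) f g : (forall t, f t = g t) -> order_sum V f = order_sum V g.
Proof. by move=> h; apply: eq_bigr. Qed.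

End OrderSums.

(** * Recursions for the probabilities *)

Lemma satf_restrict A F (l : lit) : satf A F -> A l.1 = l.2 -> satf A (restrict_cnf F l).
Proof. by move=> sA Al; rewrite (res_restrict F Al); exact: satf_res. Qed.

Lemma restrict_satf A F (l : lit) : A l.1 = l.2 -> satf A (restrict_cnf F l) -> satf A F.
Proof. by move=> Al; rewrite (res_restrict F Al); exact: res_satf. Qed.

Lemma satf_upd A F (l : lit) : wf_cnf F ->
  satf (update A l.1 l.2) F = satf A (restrict_cnf F l).
Proof.
move=> wF; have e : update A l.1 l.2 l.1 = l.2 by rewrite /update eqxx.
have -> : satf A (restrict_cnf F l) = satf (update A l.1 l.2) (restrict_cnf F l).
  apply: eq_satf; first exact: wf_restrict.
  by move=> x; rewrite !inE /update => /andP[/negPf ->].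
by apply/idP/idP => [h|]; [exact: satf_restrict | exact: restrict_satf].
Qed.

Lemma SLP F (l : lit) : wf_cnf F ->
  reflect (l.1 \in vars F /\ exists2 A, satf A F & A l.1 = l.2) (l \in SL F).
Proof.
move=> wF; have lE : (l \in lits_over (vars F)) = (l.1 \in vars F).
  by rewrite /lits_over inE /= !inE; case: (l.2); rewrite /= andbT.
have -> : (l \in SL F) = (l.1 \in vars F) && satisfiable (restrict_cnf F l).
  rewrite -lE; apply/imfsetP/idP => [[m]|h]; first by rewrite inE => h ->.
  by exists l.
apply: (iffP andP) => -[lF].
  move=> /(satisfiableP (wf_restrict wF))[A sA]; split=> //.
  exists (update A l.1 l.2); last by rewrite /update eqxx.
  by rewrite satf_upd.
case=> A sA Al; split=> //; apply/(satisfiableP (wf_restrict wF)).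
by exists A; exact: satf_restrict.
Qed.

Lemma restrictC A F x y :
  restrict_cnf (restrict_cnf F (x, A x)) (y, A y) =
  restrict_cnf (restrict_cnf F (y, A y)) (x, A x).
Proof.
by rewrite !(@res_restrict A _ (y, A y)) // !(@res_restrict A _ (x, A x)) // !resU fsetUC.
Qed.

(** Satisfying assignments of [F^[l]] extend by [l], so its satisfiable literals are among those of
    [F], and [l] itself is lost. *)
Lemma card_SL_restrict F (l : lit) : wf_cnf F -> l \in SL F ->
  (#|` SL (restrict_cnf F l)| < #|` SL F|)%N.
Proof.
move=> wF lS; rewrite (cardfsD1 l (SL F)) lS ltnS; apply: fsubset_leq_card.
apply/fsubsetP => m /(SLP _ (wf_restrict wF))[].
rewrite [_ \in vars _]in_fsetD1 => /andP[ml mF] [A sA Am].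
rewrite in_fsetD1; apply/andP; split; first by apply: contraNneq ml => ->.
apply/(SLP _ wF); split=> //; exists (update A l.1 l.2).
  by rewrite satf_upd.
by rewrite /update (negPf ml).
Qed.

Lemma cardfsD1S (V : {fset nat}) x : x \in V -> #|` V `\ x|.+1 = #|` V|.
Proof. by move=> xV; rewrite (cardfsD1 x V) xV. Qed.

Section Averages.
Variable R : realType.
Variables (s : nat) (sel : cnf -> option lit).
Hypothesis hs : selection_rule s sel.

Lemma SL_sum F (g : lit -> R) : wf_cnf F ->
  \sum_(l <- SL F) g l =
  \sum_(y <- vars F) \sum_(b : bool) (if (y, b) \in SL F then g (y, b) else 0).
Proof.
move=> wF.
transitivity (\sum_(l <- [seq (y, b) | y <- vars F, b <- index_enum bool] | l \in SL F) g l).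
  rewrite -[RHS]big_filter; apply: perm_big; apply: uniq_perm.
  - exact: fset_uniq.
  - apply: filter_uniq; apply: allpairs_uniq; rewrite ?fset_uniq ?index_enum_uniq //.
    by move=> [? ?] [? ?] _ _ /= [-> ->].
  - move=> l; rewrite mem_filter andb_idr // => /(SLP _ wF)[lV _].
    by apply/allpairsP; exists l; split=> //; rewrite ?mem_index_enum //; case: (l).
rewrite big_mkcond big_allpairs_dep /=; apply: eq_bigr => y _.
by apply: eq_bigr.
Qed.

(** Double counting: a satisfying assignment [A] with a variable [y] corresponds to the literal
    [l = (y, A y)] of [SL F] with a satisfying assignment of [F^[l]]. The hypothesis on [H] makes
    [H l] independent of the value at the removed variable. *)
Lemma assignment_sum_sat_split F (H : lit -> (nat -> bool) -> R) : wf_cnf F ->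
  (forall l A B, {in vars F `\ l.1, A =1 B} -> H l A = H l B) ->
  assignment_sum (vars F) (fun A => (satf A F)%:R * \sum_(y <- vars F) H (y, A y) A) =
  \sum_(l <- SL F) assignment_sum (vars F `\ l.1) (fun A => (satf A (restrict_cnf F l))%:R * H l A).
Proof.
move=> wF hH; rewrite SL_sum //.
transitivity (assignment_sum (vars F) (fun A => \sum_(y <- vars F) (satf A F)%:R * H (y, A y) A)).
  by apply: eq_bigr => a _; rewrite mulr_sumr.
rewrite (assignment_sum_sum _ _ (fun y A => (satf A F)%:R * H (y, A y) A)).
apply: eq_big_seq => y yV; rewrite (assignment_sum_split _ yV); apply: eq_bigr => b _.
rewrite /assignment_sum; under eq_bigr => a _.
  rewrite (satf_upd _ (y, b) wF) (hH _ _ (total_of a)); last first.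
    by move=> x; rewrite !inE /update => /andP[/negPf ->].
  rewrite {1}/update eqxx; over.
(* For a literal outside [SL F] the formula [F^[l]] is unsatisfiable, so all terms are 0. *)
case: ifPn => // /(SLP _ wF) h; apply: big1 => a _; case: (boolP (satf _ _)) => [sa|_].
  case: h; split=> //; exists (update (total_of a) y b); last by rewrite /update eqxx.
  by rewrite (satf_upd _ (y, b) wF).
by rewrite mul0r.
Qed.

(* The probability of the output [A], provided that [A] satisfies [F]: all the
   literals (y, A y) are then in [SL F]. *)
Fixpoint asl_prob_upto n (F : cnf) (A : nat -> bool) : R :=
  if n is n'.+1 then
    (\sum_(y <- vars F) asl_prob_upto n' (restrict_cnf F (y, A y)) A) / #|` SL F|%:R
  else 1.

Definition asl_prob F A : R := asl_prob_upto #|` vars F| F A.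

Lemma SL_gt0 F A : wf_cnf F -> satf A F -> vars F != fset0 -> (0 < #|` SL F|)%N.
Proof.
move=> wF sA /fset0Pn[y yV]; rewrite cardfs_gt0; apply/fset0Pn; exists (y, A y).
by apply/SLP => //; split=> //; exists A.
Qed.

Lemma SL_fset0 F : wf_cnf F -> vars F = fset0 -> SL F = fset0.
Proof.
move=> wF V0; apply/eqP; case: (fset_0Vmem (SL F)) => [->//|[l /(SLP _ wF)[]]].
by rewrite V0.
Qed.

Lemma asl_prob_rec F A : wf_cnf F -> satf A F ->
  #|` SL F|%:R * asl_prob F A = \sum_(y <- vars F) asl_prob (restrict_cnf F (y, A y)) A.
Proof.
move=> wF sA; have [V0|V0] := eqVneq (vars F) fset0.
  by rewrite V0 SL_fset0 // cardfs0 mul0r big_seq_fset0.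
have := SL_gt0 wF sA V0; rewrite -(ltr0n R) => N0.
have /fset0Pn[x xV] := V0.
rewrite /asl_prob (@card_restrict F (x, A x)) //= mulrC mulfVK ?gt_eqF //.
apply: eq_big_seq => y yV; congr asl_prob_upto; apply/eqP.
by rewrite -eqSS -(@card_restrict F (x, A x)) // -(@card_restrict F (y, A y)).
Qed.

Lemma cnf_vars_ind (P : cnf -> Prop) :
  (forall F, (forall l : lit, l.1 \in vars F -> P (restrict_cnf F l)) -> P F) ->
  forall F, P F.
Proof.
move=> h F; have [n] := ubnP #|` vars F|; elim: n F => // n IH F Fn.
by apply: h => l lF; apply: IH; rewrite (card_restrict lF) ltnS in Fn.
Qed.

Lemma eq_asl_prob_upto n F A B : {in vars F, A =1 B} -> asl_prob_upto n F A = asl_prob_upto n F B.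
Proof.
elim: n F => //= n IH F AB; congr (_ / _); apply: eq_big_seq => y yV.
rewrite AB //; apply: IH => x; rewrite !inE => /andP[_]; exact: AB.
Qed.

Lemma eq_asl_prob F A B : {in vars F, A =1 B} -> asl_prob F A = asl_prob F B.
Proof. exact: eq_asl_prob_upto. Qed.

Lemma asl_prob_ge0 F A : 0 <= asl_prob F A.
Proof.
rewrite /asl_prob; move: #|` vars F| => n; elim: n F => //= n IH F; rewrite divr_ge0 // sumr_ge0 //.
Qed.

(** Multiply by [|SL F|]. The term of [y] is p(F', A) itself; restrictions commute, so by induction
    each other term is at most its counterpart for [F'], and these add up to |SL F'| p(F', A).
    Finally |SL F'| + 1 <= |SL F|. *)
Lemma asl_prob_le F A y : wf_cnf F -> satf A F -> y \in vars F ->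
  asl_prob F A <= asl_prob (restrict_cnf F (y, A y)) A.
Proof.
elim/cnf_vars_ind: F y => F IH y wF sA yV.
set F' := restrict_cnf F (y, A y).
have wF' : wf_cnf F' by exact: wf_restrict.
have sA' : satf A F' by exact: satf_restrict.
have yS : (y, A y) \in SL F by apply/SLP => //; split=> //; exists A.
have h1 := asl_prob_rec wF sA; have h2 := asl_prob_rec wF' sA'.
have N0 : (0 : R) < #|` SL F|%:R by rewrite ltr0n (leq_trans _ (card_SL_restrict wF yS)).
rewrite -(ler_pM2l N0) h1 (big_fsetD1 y) //= -/F'.
apply: le_trans (_ : (#|` SL F'|.+1)%:R * asl_prob F' A <= _); last first.
  by rewrite ler_wpM2r ?asl_prob_ge0 // ler_nat; exact: card_SL_restrict.
rewrite -natr1 mulrDl mul1r addrC lerD2r h2 /=.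
rewrite !big_seq; apply: ler_sum => z; rewrite !inE => /andP[zy zV].
rewrite restrictC; apply: IH => //=; first exact: wf_restrict.
- exact: satf_restrict.
- by rewrite !inE eq_sym zy.
Qed.

Lemma assignment_sum_fset0 (H : (nat -> bool) -> R) : assignment_sum fset0 H = H (fun=> false).
Proof.
have e (a : assignment fset0) : total_of a = fun=> false.
  by apply/funext => x; rewrite ext_notin.
rewrite /assignment_sum; under eq_bigr do rewrite e.
by rewrite sumr_const card_assignment cardfs0.
Qed.

(** After multiplication by [|SL F|] the sum splits by the first literal chosen, and each literal
    contributes 1 by induction. *)
Lemma asl_prob_sum F : wf_cnf F -> (exists A, satf A F) ->
  assignment_sum (vars F) (fun A => (satf A F)%:R * asl_prob F A) = 1.
Proof.
elim/cnf_vars_ind: F => F IH wF [A sA].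
have [V0|V0] := eqVneq (vars F) fset0.
  rewrite V0 assignment_sum_fset0 (@eq_satf _ A) //; last by move=> x; rewrite V0.
  by rewrite sA mul1r /asl_prob V0 cardfs0.
have := SL_gt0 wF sA V0; rewrite -(ltr0n R) => N0.
apply: (mulfI (lt0r_neq0 N0)); rewrite mulr1 /assignment_sum mulr_sumr.
transitivity (assignment_sum (vars F) (fun A => (satf A F)%:R *
   \sum_(y <- vars F) asl_prob (restrict_cnf F (y, A y)) A)).
  apply: eq_bigr => a _; case: (boolP (satf _ _)) => sa; last by rewrite !mul0r mulr0.
  by rewrite !mul1r asl_prob_rec.
rewrite (@assignment_sum_sat_split F (fun l B => asl_prob (restrict_cnf F l) B)) //; last first.
  by move=> l B C BC; exact: eq_asl_prob.
rewrite -[X in _ = X%:R](sum1_size (SL F)) natr_sum; apply: eq_big_seq => l /(SLP _ wF)[lF].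
case=> B sB Bl; rewrite -[RHS](IH l lF (wf_restrict wF)) //.
by exists B; exact: satf_restrict.
Qed.

Definition guess_prob F x A : R :=
  order_sum (vars F) (fun t => (is_guessed sel A x F t)%:R) / (#|` vars F| `!)%:R.

Lemma guess_prob_ge0 F x A : 0 <= guess_prob F x A.
Proof. by rewrite divr_ge0 // sumr_ge0. Qed.

Lemma eq_guess_prob F x A B : {in vars F, A =1 B} -> guess_prob F x A = guess_prob F x B.
Proof. by move=> AB; congr (_ / _); apply: eq_order_sum => t; rewrite (eq_is_guessed _ _ hs AB). Qed.

Lemma guess_prob_notin F x A : x \notin vars F -> guess_prob F x A = 0.
Proof.
by move=> xF; rewrite /guess_prob /order_sum big1 ?mul0r // => t _; rewrite (is_guessed_notin _ _ hs).
Qed.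

(** Deleting one variable from a uniform order leaves a uniform order of the others. *)
Lemma order_sum_restrict_fact F (l : lit) (f : seq nat -> R) : l.1 \in vars F ->
  order_sum (vars (restrict_cnf F l)) f / (#|` vars (restrict_cnf F l)| `!)%:R =
  order_sum (vars F) (fun t => f (rem l.1 t)) / (#|` vars F| `!)%:R.
Proof.
move=> lF; rewrite (order_sum_rem _ lF) (card_restrict lF) factS natrM.
by rewrite invfM mulrACA divff ?mul1r // pnatr_eq0.
Qed.

Lemma guess_prob_Some F x A l : sel F = Some l -> guess_prob F x A = guess_prob (restrict_cnf F l) x A.
Proof.
move=> e; rewrite {2}/guess_prob (order_sum_restrict_fact _ (sel_in hs e)) /guess_prob.
by congr (_ / _); apply: eq_order_sum => t; rewrite (is_guessed_Some _ _ _ hs e).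
Qed.

Lemma guess_prob_mono F x A (l : lit) : wf_cnf F -> satf A F -> A l.1 = l.2 -> l.1 \in vars F ->
  guess_prob (restrict_cnf F l) x A <= guess_prob F x A.
Proof.
move=> wF sA Al lF; rewrite /guess_prob (order_sum_restrict_fact _ lF) ler_wpM2r ?invr_ge0 //.
apply: le_osum => t; rewrite ler_nat; case: (boolP (is_guessed _ _ _ (restrict_cnf _ _) _)) => // h.
by rewrite (is_guessed_restrict hs wF sA Al h).
Qed.

Lemma order_sum_const V (c : R) : order_sum V (fun=> c) = c * (#|` V| `!)%:R.
Proof.
by rewrite -order_sum_perm sumr_const card_perm_fset mulr_natr.
Qed.

(** Condition on the first variable [y]. Nothing is implied, so [x] is guessed at once if y = x,
    which gives the 1; otherwise the run continues on [F^[y = A y]]. The summand y = x is 0, as [x]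
    is no longer a variable there. *)
Lemma guess_prob_None F x A : sel F = None -> x \in vars F ->
  #|` vars F|%:R * guess_prob F x A = 1 + \sum_(y <- vars F) guess_prob (restrict_cnf F (y, A y)) x A.
Proof.
move=> e xF; have V0 : vars F != fset0 by apply/fset0Pn; exists x.
pose V := vars F; pose n := #|` V `\ x|.
have cV y : y \in V -> #|` V `\ y| = n.
  by move=> yV; apply/eqP; rewrite -eqSS !cardfsD1S.
have n0 : (n`!)%:R != 0 :> R by rewrite pnatr_eq0 -lt0n fact_gt0.
rewrite /guess_prob order_sum_head // (cardfsD1 x) xF add1n -/V -/n factS natrM.
have m0 : (n.+1)%:R != 0 :> R by rewrite pnatr_eq0.
have -> : \sum_(y <- V) order_sum (V `\ y) (fun t => (is_guessed sel A x F (y :: t))%:R) =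
  (n`!)%:R * (1 + \sum_(y <- V) guess_prob (restrict_cnf F (y, A y)) x A); last first.
  by field; rewrite n0 addrC natr1 m0.
rewrite mulrDr mulr1 mulr_sumr.
rewrite [X in X + _](_ : _ = \sum_(y <- V) ((x == y)%:R * n`!%:R)); last first.
  rewrite (big_fsetD1 x) //= eqxx mul1r big_seq big1 ?addr0 // => y.
  by rewrite !inE eq_sym => /andP[/negPf -> _]; rewrite mul0r.
rewrite -big_split /=; apply: eq_big_seq => y yV.
rewrite /guess_prob /= cV // [n`!%:R * _]mulrC divfK //.
rewrite closure_None //= xF andbT /assign_cnf [y \in vars F]yV.
case: eqP => [<-|_] /=; last by rewrite mul0r add0r.
rewrite order_sum_const cV // -[LHS]addr0; congr (_ + _).
rewrite /order_sum big1 // => t _; rewrite (is_guessed_notin _ _ hs) //= !inE eqxx //.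
Qed.

(** Success is read off from the final formula having no clauses, a condition that follows the
    recursion of the run. *)
Definition solve_prob F : R :=
  assignment_sum (vars F) (fun a => order_sum (vars F) (fun t => (clauses (final_cnf sel a F t) == fset0)%:R))
  / ((2 ^ #|` vars F|)%:R * (#|` vars F| `!)%:R).

Lemma solve_prob_ge0 F : 0 <= solve_prob F.
Proof. by rewrite divr_ge0 ?mulr_ge0 // sumr_ge0 // => a _; rewrite sumr_ge0. Qed.

(** Neither the bit at the variable of [l] nor the place of that variable in the order has any
    influence; they account for the factors 2 and [|vars F|]. *)
Lemma solve_prob_Some F l : sel F = Some l -> solve_prob F = solve_prob (restrict_cnf F l).
Proof.
move=> e; have lF := sel_in hs e; rewrite /solve_prob.
pose H a := order_sum (vars F) (fun t => (clauses (final_cnf sel a F t) == fset0)%:R : R).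
pose H' a := order_sum (vars F `\ l.1)
   (fun t => (clauses (final_cnf sel a (restrict_cnf F l) t) == fset0)%:R : R).
have HE a : H a = #|` vars F|%:R * H' a.
  rewrite /H' -(order_sum_rem _ lF); apply: eq_order_sum => t; by rewrite (final_cnf_Some _ _ hs e).
have HU a b : H (update a l.1 b) = H a.
  rewrite !HE; congr (_ * _); apply: eq_order_sum => t; congr ((clauses _ == _)%:R).
  by apply: (eq_final_cnf _ hs) => x; rewrite !inE /update => /andP[/negPf ->].
rewrite -/H -/H' (assignment_sum_ind lF HU) /assignment_sum.
under eq_bigr do rewrite HE.
rewrite -mulr_sumr mulrA (card_restrict lF) expnS factS !natrM /=.
have n0 : (#|` vars F `\ l.1|.+1)%:R != 0 :> R by rewrite pnatr_eq0.
set n := #|` vars F `\ l.1| in n0 *.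
have f0 : (n`!)%:R != 0 :> R by rewrite pnatr_eq0 -lt0n fact_gt0.
have p0 : (2 ^ n)%:R != 0 :> R by rewrite pnatr_eq0 -lt0n expn_gt0.
by field; rewrite f0 p0 addrC natr1 n0.
Qed.

(** The first variable and its bit are uniform and independent, and what follows is a uniform run on
    the restricted formula. *)
Lemma solve_prob_None F : sel F = None -> vars F != fset0 ->
  2 * #|` vars F|%:R * solve_prob F = \sum_(y <- vars F) \sum_(b : bool) solve_prob (restrict_cnf F (y, b)).
Proof.
move=> e V0; have /fset0Pn[x xF] := V0.
pose V := vars F; pose n := #|` V `\ x|.
have cV y : y \in V -> #|` V `\ y| = n.
  by move=> yV; apply/eqP; rewrite -eqSS !cardfsD1S.
have n0 : (n.+1)%:R != 0 :> R by rewrite pnatr_eq0.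
have f0 : (n`!)%:R != 0 :> R by rewrite pnatr_eq0 -lt0n fact_gt0.
have p0 : (2 ^ n)%:R != 0 :> R by rewrite pnatr_eq0 -lt0n expn_gt0.
rewrite /solve_prob (cardfsD1 x) xF add1n -/V -/n expnS factS !natrM.
have -> : assignment_sum V (fun a => order_sum V (fun t => (clauses (final_cnf sel a F t) == fset0)%:R)) =
    \sum_(y <- V) assignment_sum V (fun a => order_sum (V `\ y)
      (fun t => (clauses (final_cnf sel a F (y :: t)) == fset0)%:R)) :> R.
  by rewrite -assignment_sum_sum; apply: eq_bigr => a _; rewrite order_sum_head.
apply: (@mulIf _ ((2 ^ n)%:R * n`!%:R)); first by rewrite mulf_neq0.
rewrite [LHS](_ : _ = \sum_(y <- V) assignment_sum V (fun a => order_sum (V `\ y)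
    (fun t => (clauses (final_cnf sel a F (y :: t)) == fset0)%:R))); last first.
  by field; rewrite f0 p0 addrC natr1 n0.
rewrite mulr_suml; apply: eq_big_seq => y yV; rewrite (assignment_sum_split _ yV) mulr_suml.
apply: eq_bigr => b _; rewrite /= cV // mulfVK ?mulf_neq0 //.
apply: eq_bigr => a _; apply: eq_order_sum => t; congr ((clauses _ == _)%:R).
have ub : update (total_of a) y b y = b by rewrite /update eqxx.
rewrite final_cnf_cons closure_None // /assign_cnf [y \in vars F]yV ub.
by apply: (eq_final_cnf _ hs) => z; rewrite !inE /update => /andP[/negPf ->].
Qed.

Lemma solve_prob_fset0 F : wf_cnf F -> (exists A, satf A F) -> vars F = fset0 -> solve_prob F = 1.
Proof.
move=> wF [A /satfP sA] V0.
have c0 : clauses F = fset0.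
  case: (fset_0Vmem (clauses F)) => // -[C CF]; have /satcP[l lC _] := sA C CF.
  by have := (wF C CF).1 l lC; rewrite V0.
rewrite /solve_prob V0 assignment_sum_fset0 order_sum_fset0 cardfs0 /= fact0 mulr1 divr1.
by rewrite /final_cnf /= /closure_cnf V0 cardfs0 /= c0 eqxx.
Qed.

End Averages.

(** * Runs of the procedures *)

Definition lits_on (A : nat -> bool) (W : {fset nat}) : {fset lit} :=
  [fset ((x, A x) : lit) | x in W].

Lemma in_lits_on A W (l : lit) : (l \in lits_on A W) = (l.1 \in W) && (A l.1 == l.2).
Proof.
apply/imfsetP/andP => [[x /= xW ->] //=|[lW /eqP e]]; exists l.1 => //.
by rewrite e; exact: surjective_pairing.
Qed.

Lemma lits_ofE V (a : assignment V) : lits_of a = lits_on (total_of a) V.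
Proof. by apply/fsetP => l; rewrite lits_ofP in_lits_on. Qed.

Lemma eq_lits_on A B (W : {fset nat}) : {in W, A =1 B} -> lits_on A W = lits_on B W.
Proof.
move=> AB; apply/fsetP => l; rewrite !in_lits_on.
by case: (boolP (l.1 \in W)) => //= /AB ->.
Qed.

Section Runs.
Variables (s : nat) (sel : cnf -> option lit).
Hypothesis hs : selection_rule s sel.

Lemma guessed_propagate n st : guessed (propagate sel n st) = guessed st.
Proof. by elim: n st => //= n IH st; case: (sel _) => //= l; rewrite IH. Qed.

Lemma current_step (V : {fset nat}) (b : assignment V) st z :
  current (ppsz_step sel b st z) = assign_cnf (total_of b) (closure_cnf sel (current st)) (val z).
Proof.
rewrite /ppsz_step /assign_cnf /closure_cnf current_propagate extE.
by case: ifP => _ //=; rewrite current_propagate.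
Qed.

Lemma guessed_run (V : {fset nat}) (b : assignment V) x st (t : seq V) :
  (x \in guessed (foldl (ppsz_step sel b) st t)) =
  (x \in guessed st) || is_guessed sel (total_of b) x (current st) (map val t).
Proof.
elim: t st => [|z t IH] st /=; first by rewrite orbF.
rewrite IH current_step orbA; congr orb.
rewrite /ppsz_step /closure_cnf current_propagate.
case: ifPn => [zc|zc]; last first.
  rewrite guessed_propagate; case: eqP => [->|_] /=; last by rewrite orbF.
  by rewrite (negPf zc) orbF.
rewrite /= !inE guessed_propagate orbC; congr orb.
by case: eqP => // ->.
Qed.

Lemma current_run (V : {fset nat}) (b : assignment V) st (t : seq V) :
  closure_cnf sel (current (foldl (ppsz_step sel b) st t)) =
  final_cnf sel (total_of b) (current st) (map val t).
Proof.
elim: t st => [|z t IH] st //=.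
by rewrite IH current_step final_cnf_cons.
Qed.

(** Invariant of a run: one pair [A], [W] accounts for both the recorded literals and the current
    formula. [A] may falsify [F], since guesses can be wrong. *)
Definition consistent_state (F : cnf) (st : ppsz_state) : Prop :=
  exists A W, [/\ W `<=` vars F, recorded st = lits_on A W & current st = restrict_on A W F].

Lemma consistent_restrict F st l g : wf_cnf F -> l.1 \in vars (current st) ->
  consistent_state F st ->
  consistent_state F (PPSZState (restrict_cnf (current st) l) (l |` recorded st) g).
Proof.
move=> wF lc [A [W [WF rW cW]]]; move: lc; rewrite cW /= inE => /andP[lW lF].
have AA' : {in W, A =1 update A l.1 l.2}.
  by move=> x xW; rewrite /update; case: eqP => // e; rewrite -e xW in lW.
have A'l : update A l.1 l.2 l.1 = l.2 by rewrite /update eqxx.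
exists (update A l.1 l.2), (l.1 |` W); split=> /=.
- by rewrite fsubUset fsub1set lF.
- rewrite rW (eq_lits_on AA'); apply/fsetP => m.
  rewrite in_lits_on !inE in_lits_on andb_orl; congr orb.
  apply/eqP/andP => [->|[/eqP e /eqP]]; first by rewrite A'l !eqxx.
  by rewrite e A'l => e2; rewrite [m]surjective_pairing e -e2 -surjective_pairing.
- by rewrite (eq_restrict_on F AA') (res_restrict _ A'l) resU fsetUC.
Qed.

Lemma consistent_propagate F n st : wf_cnf F ->
  consistent_state F st -> consistent_state F (propagate sel n st).
Proof.
move=> wF; elim: n st => //= n IH st cst; case e: (sel _) => [l|] //.
by apply: IH; apply: consistent_restrict => //; exact: sel_in hs e.
Qed.

Lemma consistent_run F (V : {fset nat}) (b : assignment V) st (t : seq V) : wf_cnf F ->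
  consistent_state F st -> consistent_state F (foldl (ppsz_step sel b) st t).
Proof.
move=> wF; elim: t st => //= z t IH st cst; apply: IH; rewrite /ppsz_step.
have := consistent_propagate #|` vars (current st)| wF cst.
set st' := propagate _ _ _ => cst'; case: ifP => // zc.
by apply: consistent_restrict.
Qed.

Lemma vars_run (V : {fset nat}) (b : assignment V) st (t : seq V) x :
  x \in vars (current (foldl (ppsz_step sel b) st t)) ->
  (x \in vars (current st)) && (x \notin map val t).
Proof.
elim: t st => [|z t IH] st /=; first by rewrite andbT.
move/IH; rewrite current_step vars_stp !inE negb_or -andbA => /and3P[-> xc ->].
by rewrite !andbT; exact: (fsubsetP (vars_closure _ hs)).
Qed.

(** After the last turn no variable is left, so the [W] of the invariant is [vars F] and the output
    is [A]; as no clause is left either, [A] satisfies [F]. *)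
Lemma ppsz_success F (b : assignment (vars F)) (p : {perm vars F}) : wf_cnf F ->
  clauses (final_cnf sel (total_of b) F (map val (codom p))) == fset0 ->
  [exists a in sat F, ppsz sel b p == lits_of a].
Proof.
move=> wF; rewrite -(current_run b (PPSZState F fset0 fset0)) -/(ppsz_run sel b p).
have v0 : vars (current (ppsz_run sel b p)) = fset0.
  apply/eqP; case: (fset_0Vmem (vars (current (ppsz_run sel b p)))) => [->//|[x xr]].
  have /andP[/= xF] := vars_run xr; case/mapP; exists [` xF] => //.
  by rewrite -(permKV p [` xF]) codom_f.
rewrite /closure_cnf v0 cardfs0 /= => /eqP c0.
have : consistent_state F (ppsz_run sel b p).
  apply: consistent_run => //; exists (fun=> false), fset0; rewrite res0 fsub0set.
  by split=> //; apply/fsetP => l; rewrite in_lits_on !inE.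
case=> A [W [WF rW cW]]; have eW : W = vars F.
  apply/eqP; rewrite eqEfsubset WF /=; move: v0; rewrite cW /= => /eqP.
  by rewrite fsetD_eq0.
rewrite eW in rW cW; have eA : {in vars F, total_of (assignment_of (vars F) A) =1 A} by exact: ext_inj.
apply/existsP; exists (assignment_of (vars F) A); rewrite in_satE // lits_ofE (eq_lits_on eA).
rewrite -rW eqxx andbT; apply: (res_satf eA); rewrite -cW.
by apply/satfP => C; rewrite c0.
Qed.

Variable R : realType.

Lemma card_pred_sum (T : finType) (P : pred T) : #|P|%:R = \sum_x (P x)%:R :> R.
Proof.
rewrite -sum1_card natr_sum big_mkcond; apply: eq_bigr => x _.
by rewrite unfold_in; case: (P x).
Qed.

Lemma p_guessedE F x (a : assignment (vars F)) : p_guessed R sel x a = guess_prob R sel F x (total_of a).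
Proof.
rewrite /p_guessed /unif_prob /guess_prob -order_sum_perm card_perm_fset; congr (_ / _).
by rewrite card_pred_sum; apply: eq_bigr => p _; rewrite guessed_run.
Qed.

Lemma p_success_ge F : wf_cnf F -> solve_prob R sel F <= p_success R sel F.
Proof.
move=> wF; rewrite /p_success /unif_prob /solve_prob card_prod card_assignment card_perm_fset natrM.
rewrite ler_wpM2r ?invr_ge0 ?mulr_ge0 // card_pred_sum /assignment_sum.
under eq_bigr do rewrite -order_sum_perm.
rewrite pair_big /=; apply: ler_sum => -[b p] _ /=; rewrite ler_nat.
by case: (boolP (_ == _)) => // /(ppsz_success wF) ->.
Qed.

Lemma asl_notsub n F (acc out : {fset lit}) : ~~ (acc `<=` out) -> asl R n F acc out = 0.
Proof.
elim: n F acc => [|n IH] F acc h /=; first by case: eqP h => // ->; rewrite fsubset_refl.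
rewrite big1 // => l _; rewrite IH ?mulr0 //; apply: contra h.
by rewrite fsubUset => /andP[].
Qed.

(** [acc] has no literal over a remaining variable, so choosing [(y, b)] with [b] different from
    [A y] leaves the target for good and contributes 0. *)
Lemma asl_pan n F A (acc : {fset lit}) : #|` vars F| = n -> wf_cnf F -> satf A F ->
  (forall l : lit, l \in acc -> l.1 \notin vars F) ->
  asl R n F acc (acc `|` lits_on A (vars F)) = asl_prob_upto R n F A.
Proof.
elim: n F acc => [|n IH] F acc Fn wF sA hacc.
  have /eqP V0 : vars F == fset0 by rewrite -cardfs_eq0 Fn.
  rewrite /= (_ : lits_on _ _ = fset0) ?fsetU0 ?eqxx //.
  by apply/fsetP => l; rewrite in_lits_on V0 !inE.
rewrite [LHS]/= SL_sum //= mulr_suml; apply: eq_big_seq => y yV.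
have yS : (y, A y) \in SL F by apply/SLP => //; split=> //; exists A.
rewrite (bigD1 (A y)) //= yS [X in _ + X]big1 => [|b /negPf bA]; last first.
  case: ifP => // _; rewrite asl_notsub ?mulr0 // fsubUset fsub1set inE in_lits_on /= yV.
  rewrite eq_sym bA orbF; case: (boolP (_ \in acc)) => // /hacc.
  by rewrite yV.
rewrite addr0 mulrC; congr (_ / _).
rewrite (_ : acc `|` _ = (y, A y) |` acc `|` lits_on A (vars (restrict_cnf F (y, A y)))).
  apply: IH => /=.
  - by apply/eqP; rewrite -eqSS cardfsD1S ?Fn.
  - exact: wf_restrict.
  - exact: satf_restrict.
  - move=> l; rewrite inE => /orP[|/hacc]; first by rewrite inE => /eqP ->; rewrite !inE eqxx.
    by apply: contra; rewrite !inE => /andP[].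
apply/fsetP => l; rewrite in_fsetU in_lits_on in_fsetU in_fset1U in_lits_on /= in_fsetD1.
case: (boolP (l \in acc)) => [_|_]; first by rewrite orbT.
rewrite /= orbF; case: (eqVneq l (y, A y)) => [->|ly] /=; first by rewrite yV eqxx.
case: (eqVneq l.1 y) => [e|//]; rewrite e yV /=; apply/eqP => e2.
by case/eqP: ly; rewrite [l]surjective_pairing e e2.
Qed.

Lemma p_aslE F (a : assignment (vars F)) : wf_cnf F -> a \in sat F ->
  p_asl R a = asl_prob R F (total_of a).
Proof.
move=> wF; rewrite in_satE // => sa; rewrite /p_asl lits_ofE -[lits_on _ _]fset0U.
by rewrite asl_pan.
Qed.

(** * Frozen variables and their cost *)

Definition agree F x := forall A B, satf A F -> satf B F -> A x = B x.

Lemma frozenP F (y : vars F) : wf_cnf F -> reflect (agree F (val y)) (frozen y).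
Proof.
move=> wF; apply: (iffP forallP) => [h A B sA sB|h a].
  have sat_inj C : satf C F -> assignment_of (vars F) C \in sat F.
    by move=> sC; rewrite in_satE // (@eq_satf _ C) //; exact: ext_inj.
  have /implyP/(_ (sat_inj A sA))/forallP/(_ (assignment_of (vars F) B)) := h (assignment_of (vars F) A).
  by move/implyP => /(_ (sat_inj B sB)); rewrite !ffunE => /eqP.
apply/implyP => sa; apply/forallP => b; apply/implyP => sb.
by rewrite -!extE; apply/eqP; apply: h; rewrite -in_satE.
Qed.

Lemma var_cost_out (S : R) F x : x \notin vars F -> var_cost sel S F x = 0.
Proof. by move=> xF; rewrite /var_cost insubN. Qed.

Lemma var_cost_free (S : R) F x : wf_cnf F -> x \in vars F -> ~ agree F x ->
  var_cost sel S F x = S.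
Proof.
move=> wF xF h; rewrite /var_cost insubT; case: ifP => // /(frozenP _ wF).
by [].
Qed.

Lemma var_cost_frozen (S : R) F x : wf_cnf F -> x \in vars F -> agree F x ->
  var_cost sel S F x =
  assignment_sum (vars F) (fun A => (satf A F)%:R * (asl_prob R F A * guess_prob R sel F x A)).
Proof.
move=> wF xF h; rewrite /var_cost insubT.
have -> : frozen (Sub x xF : vars F) by exact/(frozenP _ wF).
rewrite big_mkcond; apply: eq_bigr => a _; rewrite -in_satE //.
by case: ifP => sa; rewrite ?mul0r // mul1r p_aslE // p_guessedE.
Qed.

End Runs.

(** * Numerical bounds *)

Section Numeric.
Import numFieldNormedType.Exports.
Variable R : realType.

(** Equivalent to exp (12/17) >= 2, which follows from 1 + x <= exp x at x = 12/17/32 by five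
    squarings with rational lower bounds. *)
Lemma ln2_le : ln 2 <= 12 / 17 :> R.
Proof.
rewrite -[leRHS]expRK ler_ln ?posrE ?expR_gt0 //.
have step (y z x : R) : 0 <= y -> z <= y ^+ 2 -> y <= expR x -> z <= expR (x * 2).
  move=> y0 zy h; rewrite mulr_natr mulr2n expRD (le_trans zy) // expr2.
  by rewrite ler_pM.
have h0 : 139 / 136 <= expR (12 / 17 / 32 : R).
  by apply: le_trans (expR_ge1Dx _); lra.
have h1 : 164 / 157 <= expR (12 / 17 / 16 : R).
  by rewrite (_ : 12 / 17 / 16 = 12 / 17 / 32 * 2); [apply: step h0; lra | field].
have h2 : 12 / 11 <= expR (12 / 17 / 8 : R).
  by rewrite (_ : 12 / 17 / 8 = 12 / 17 / 16 * 2); [apply: step h1; lra | field].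
have h3 : 119 / 100 <= expR (12 / 17 / 4 : R).
  by rewrite (_ : 12 / 17 / 4 = 12 / 17 / 8 * 2); [apply: step h2; lra | field].
have h4 : 58 / 41 <= expR (12 / 17 / 2 : R).
  by rewrite (_ : 12 / 17 / 2 = 12 / 17 / 4 * 2); [apply: step h3; lra | field].
by rewrite (_ : 12 / 17 = 12 / 17 / 2 * 2); [apply: step h4; lra | field].
Qed.

Lemma powR2_tangent (d : R) : 2 * (1 + (d - 1) * ln 2) <= 2 `^ d.
Proof.
have e : 2 `^ d = 2 * expR ((d - 1) * ln 2).
  have n2 : ((2 : R) == 0) = false by rewrite pnatr_eq0.
  rewrite /powR n2 mulrBl mul1r expRB lnK ?posrE //.
  by field.
by rewrite e ler_wpM2l // expR_ge1Dx.
Qed.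

(** A polynomial minorant that integrates exactly. For k = 3 the integrand is u / (1 + u) with u =
    sqrt t; it and the minorant both tend to 0 at 0 and to 1/2 at 1. *)
Lemma integrand_ge (k : nat) (t : R) : (3 <= k)%N -> 0 <= t < 1 ->
  (3 * t - t ^+ 2) / 4 <= (t `^ (k%:R - 1)^-1 - t) / (1 - t).
Proof.
move=> k3 /andP[t0 t1]; have d0 : 0 < 1 - t by rewrite subr_gt0.
rewrite ler_pdivlMr //.
(* The exponent is at most 1/2 and t < 1, so k = 3 is the worst case. *)
have p2 : Num.sqrt t <= t `^ (k%:R - 1)^-1.
  rewrite -powR12_sqrt // ; have [->|tn0] := eqVneq t 0.
    by rewrite powR0 ?powR_ge0 // invr_eq0 pnatr_eq0.
  have tp : 0 < t by rewrite lt_neqAle eq_sym tn0.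
  rewrite /powR (negPf tn0) ler_expR; apply: ler_wnM2r; first by rewrite ln_le0 // ltW.
  rewrite lef_pV2 ?posrE //.
    by rewrite lerBrDr (_ : 2 + 1 = 3 :> R) ?ler_nat //; ring.
  by rewrite subr_gt0 ltr1n; exact: leq_trans k3.
apply: le_trans (_ : Num.sqrt t - t <= _); last by rewrite lerD2r.
have u0 := sqrtr_ge0 t; have e := sqr_sqrtr t0.
have u1 : Num.sqrt t < 1 by rewrite -sqrtr1 ltr_sqrt.
set u := Num.sqrt t in u0 u1 e *; rewrite -e.
have u2 : u ^+ 2 <= 1 by rewrite expr_le1 // ltW.
have u3 : u ^+ 3 <= 1 by rewrite expr_le1 // ltW.
(* This product is four times the difference of the two sides of the goal, with t = u^2; its last
   factor is positive because u^2 and u^3 are at most 1. *)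
have key : 0 <= u * (1 - u) ^+ 2 * (4 + u - 2 * u ^+ 2 - u ^+ 3).
  by rewrite mulr_ge0 ?mulr_ge0 ?sqr_ge0 //; lra.
lra.
Qed.

Lemma integrand_le1 (k : nat) (t : R) : (3 <= k)%N -> 0 <= t <= 1 ->
  0 <= (t `^ (k%:R - 1)^-1 - t) / (1 - t) <= 1.
Proof.
move=> k3 /andP[t0 t1].
have k0 : (0 : R) <= (k%:R - 1)^-1.
  by rewrite invr_ge0 subr_ge0 ler1n; exact: leq_trans k3.
have [->|tn1] := eqVneq t 1; first by rewrite subrr invr0 mulr0 lexx ler01.
have d0 : 0 < 1 - t by rewrite subr_gt0 lt_neqAle tn1.
have p1 : t `^ (k%:R - 1)^-1 <= 1.
  have := @ge0_ler_powR R _ k0 t 1; rewrite !nnegrE powR1; apply; rewrite ?ler01 //.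
apply/andP; split; last by rewrite ler_pdivrMr // mul1r lerD2r.
apply: le_trans (integrand_ge k3 _); last by rewrite t0 -subr_gt0.
by rewrite divr_ge0 // subr_ge0; nra.
Qed.

Lemma integral_bound : \int[lebesgue_measure]_(t in `[0%R, 1%R]%classic)
     ((3 * t - t ^+ 2) / 4) = 7 / 24 :> R.
Proof.
pose P : {poly R} := (3 / 8) *: 'X^2 - (1 / 12) *: 'X^3.
have PE : horner P^`() = fun t => (3 * t - t ^+ 2) / 4.
  by apply/funext => t; rewrite /P !poly.derivE !hornerE /=; field.
transitivity (\int[lebesgue_measure]_(t in `[0%R, 1%R]%classic) horner P^`() t).
  by rewrite PE.
rewrite /Rintegral (@continuous_FTC2 _ _ (horner P)) ?ltr01 //.
- by rewrite -EFinB /= /P !hornerE /=; field.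
- by apply: continuous_subspaceT => x; exact: continuous_horner.
- split=> [x _| |]; first exact: derivable_horner.
    by apply: cvg_at_right_filter; exact: continuous_horner.
  by apply: cvg_at_left_filter; exact: continuous_horner.
- by move=> x _; rewrite derivE.
Qed.

Lemma S_int_ge (k : nat) : (3 <= k)%N -> 7 / 24 <= S_int R k.
Proof.
move=> k3; rewrite -integral_bound /S_int.
pose f (t : R) := (t `^ (k%:R - 1)^-1 - t) / (1 - t).
pose g (t : R) := (3 * t - t ^+ 2) / 4.
have mI : measurable (`[0%R, 1%R]%classic : set R) by exact: measurable_itv.
have muI : (lebesgue_measure (`[0%R, 1%R]%classic : set R) < +oo)%E.
  by rewrite lebesgue_measure_itv /= lte_fin ltr01 -EFinB ltry.
have fI : lebesgue_measure.-integrable `[0, 1]%classic (EFin \o f).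
  apply: measurable_bounded_integrable => //; last first.
    exists 1; split=> // x x1 t /=; rewrite in_itv /= => t01.
    have /andP[f0 f1] := integrand_le1 k3 t01.
    by rewrite ger0_norm // (le_trans f1) // ltW.
  (* The inverse is rewritten as a real power, which is measurable; at t = 1 both are 0. *)
  apply: (@eq_measurable_fun _ _ _ _ _
     (fun t : R => (t `^ (k%:R - 1)^-1 - t) * (1 - t) `^ (- 1))).
    move=> t; rewrite inE /= in_itv /= => /andP[_ t1].
    by rewrite powR_inv1 // subr_ge0.
  apply: measurable_funTS; apply: measurable_funM.
    by apply: measurable_funB => //; exact: measurable_powR.
  apply: (@measurableT_comp _ _ _ _ _ _ (fun u : R => u `^ (- 1))).
    exact: measurable_powR.
  exact: measurable_funB.
have gI : lebesgue_measure.-integrable `[0, 1]%classic (EFin \o g).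
  apply: measurable_bounded_integrable => //.
    apply: measurable_funTS; apply: measurable_funM => //; apply: measurable_funB.
      exact: measurable_funM.
    exact: measurable_funX.
  exists 4; split=> // x x1 t /=; rewrite in_itv /= => /andP[t0 t1].
  rewrite ler_norml /g; apply/andP; split; nra.
have sub : ((`[0%R, 1%R[%classic : set R) `<=` `[0%R, 1%R])%classic.
  by move=> t /=; rewrite !in_itv /= => /andP[-> /ltW].
have mO : measurable (`[0%R, 1%R[%classic : set R) by exact: measurable_itv.
have fO : lebesgue_measure.-integrable `[0, 1[%classic (EFin \o f).
  exact: integrableS fI.
have gO : lebesgue_measure.-integrable `[0, 1[%classic (EFin \o g).
  exact: integrableS gI.
(* The endpoint 1 is removed: the integrand is 0 there and the minorant 1/2. *)
rewrite -!Rintegral_itv_bndo_bndc //; apply: le_Rintegral => // t /=.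
by rewrite in_itv /=; exact: integrand_ge.
Qed.

End Numeric.

(** * The induction *)

Lemma le_cnf_restrict k F (l : lit) : le_cnf k F -> le_cnf k (restrict_cnf F l).
Proof.
case=> wF Fk; split; first exact: wf_restrict.
move=> C /imfsetP[/= D]; rewrite inE => /andP[/= DF _] ->.
by apply: leq_trans (Fk D DF); apply: fsubset_leq_card; exact: fsubD1set.
Qed.

Lemma agree_restrict F (l : lit) x : wf_cnf F -> x \in vars F `\ l.1 -> agree F x ->
  agree (restrict_cnf F l) x.
Proof.
move=> wF; rewrite !inE => /andP[xl _] h A B sA sB.
have := h (update A l.1 l.2) (update B l.1 l.2).
by rewrite !satf_upd // /update (negPf xl); apply.
Qed.

Section Main.
Variables (R : realType) (k s : nat) (sel : cnf -> option lit) (S : R).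
Hypothesis hs : selection_rule s sel.
Hypothesis hS : forall F' : cnf, le_cnf k F' -> satisfiable F' ->
      forall x : vars F', frozen x ->
      forall alpha : assignment (vars F'), alpha \in sat F' ->
      p_guessed R sel (val x) alpha <= S.
Hypothesis S0 : 0 <= S.

Let vc := var_cost sel S.

Lemma sumr_const_fset (T : choiceType) (V : {fset T}) (c : R) :
  \sum_(y <- V) c = #|` V|%:R * c.
Proof. by rewrite big_const_seq count_predT iter_addr_0 mulr_natl. Qed.

Lemma le_asum V (f g : (nat -> bool) -> R) : (forall a : assignment V, f (total_of a) <= g (total_of a)) ->
  assignment_sum V f <= assignment_sum V g.
Proof. by move=> h; apply: ler_sum. Qed.

Lemma var_cost_ge0 F x : wf_cnf F -> 0 <= vc F x.
Proof.
move=> wF; have [xF|xF] := boolP (x \in vars F); last by rewrite /vc var_cost_out.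
have [h|h] := pselect (agree F x); last by rewrite /vc var_cost_free.
rewrite /vc var_cost_frozen //; apply: sumr_ge0 => a _.
by rewrite mulr_ge0 ?ler0n // mulr_ge0 ?asl_prob_ge0 ?guess_prob_ge0.
Qed.

(** The cost of a frozen variable averages probabilities that are at most [S], with weights of total
    mass 1. *)
Lemma var_cost_le F x : le_cnf k F -> (exists A, satf A F) -> vc F x <= S.
Proof.
move=> lF eF; have wF := lF.1; have sF : satisfiable F by exact/satisfiableP.
have [xF|xF] := boolP (x \in vars F); last by rewrite /vc var_cost_out.
have [h|h] := pselect (agree F x); last by rewrite /vc var_cost_free.
rewrite /vc var_cost_frozen // -[leRHS]mul1r -[X in _ <= X * _](asl_prob_sum R wF eF) /assignment_sum mulr_suml.
apply: ler_sum => a _; case: (boolP (satf _ _)) => sa; last by rewrite !mul0r.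
rewrite !mul1r ler_wpM2l ?asl_prob_ge0 // -p_guessedE.
apply: (hS lF sF (x := [` xF])); last by rewrite in_satE.
exact/frozenP.
Qed.

Lemma assignment_sum_forced F (l : lit) (h : (nat -> bool) -> R) : wf_cnf F -> l.1 \in vars F ->
  (forall A, satf A F -> A l.1 = l.2) ->
  assignment_sum (vars F) (fun A => (satf A F)%:R * h A) =
  assignment_sum (vars F `\ l.1) (fun A => (satf A (restrict_cnf F l))%:R * h (update A l.1 l.2)).
Proof.
move=> wF lF fl; rewrite (assignment_sum_split _ lF) (bigD1 l.2) //= [X in _ + X]big1 ?addr0.
  by apply: eq_bigr => a _; rewrite satf_upd.
move=> b bl; rewrite /assignment_sum big1 // => a _; case: (boolP (satf _ _)) => [/fl|_].
  by rewrite /update eqxx => e; rewrite e eqxx in bl.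
by rewrite mul0r.
Qed.

(* Both distributions have total mass 1 and one dominates the other. *)
Lemma asl_prob_forced F (l : lit) (A : assignment (vars F `\ l.1)) : wf_cnf F -> l.1 \in vars F ->
  (forall A, satf A F -> A l.1 = l.2) -> satf (total_of A) (restrict_cnf F l) ->
  asl_prob R F (update (total_of A) l.1 l.2) = asl_prob R (restrict_cnf F l) (total_of A).
Proof.
move=> wF lF fl sA; have wl := wf_restrict (l := l) wF.
have ul B : update B l.1 l.2 l.1 = l.2 by rewrite /update eqxx.
have le B : satf B (restrict_cnf F l) ->
    asl_prob R F (update B l.1 l.2) <= asl_prob R (restrict_cnf F l) B.
  move=> sB; have sU : satf (update B l.1 l.2) F by rewrite satf_upd.
  apply: le_trans (asl_prob_le R wF sU lF) _; rewrite ul -surjective_pairing.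
  by rewrite (@eq_asl_prob _ _ _ B) // => x; rewrite !inE /update => /andP[/negPf ->].
pose d B := (satf B (restrict_cnf F l))%:R *
  (asl_prob R (restrict_cnf F l) B - asl_prob R F (update B l.1 l.2)) : R.
have d0 (B : assignment (vars F `\ l.1)) : true -> 0 <= d (total_of B).
  move=> _; rewrite /d; case: (boolP (satf _ _)) => sB; last by rewrite mul0r.
  by rewrite mul1r subr_ge0 le.
have : assignment_sum (vars F `\ l.1) d = 0.
  rewrite /d /assignment_sum; under eq_bigr do rewrite mulrBr.
  rewrite sumrB; apply/eqP; rewrite subr_eq0; apply/eqP.
  transitivity (1 : R); first by apply: (asl_prob_sum R wl); exists (total_of A).
  rewrite -[LHS](asl_prob_sum R wF); last by exists (update (total_of A) l.1 l.2); rewrite satf_upd.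
  exact: (assignment_sum_forced (asl_prob R F) wF lF fl).
move=> /eqP; rewrite psumr_eq0 // => /allP/(_ A (mem_index_enum _)) /=.
by rewrite /d sA mul1r subr_eq0 => /eqP ->.
Qed.

(** As [l] is forced, for [x] frozen in [F] neither the weights nor the guessing probabilities
    change; for [x] non-frozen the cost in [F] is [S], the largest possible. *)
Lemma var_cost_Some F l x : le_cnf k F -> (exists A, satf A F) -> sel F = Some l ->
  vc (restrict_cnf F l) x <= vc F x.
Proof.
move=> lcF [A sA] e; have wF := lcF.1; have lF := sel_in hs e.
have wl := wf_restrict (l := l) wF.
have il : implied s F l by have := hs F; rewrite e.
have fl B : satf B F -> B l.1 = l.2 by move=> sB; exact: implied_sat il sB.
have el : exists B, satf B (restrict_cnf F l).
  by exists A; apply: satf_restrict => //; exact: fl.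
have [xl|xl] := boolP (x \in vars (restrict_cnf F l)); last first.
  by rewrite {1}/vc var_cost_out // var_cost_ge0.
have xF : x \in vars F by move: xl; rewrite !inE => /andP[].
have [h|h] := pselect (agree F x); last first.
  rewrite [leRHS]/vc var_cost_free //; apply: var_cost_le el.
  exact: le_cnf_restrict.
have h' := agree_restrict wF xl h.
rewrite /vc !var_cost_frozen // (assignment_sum_forced _ wF lF fl).
apply: le_asum => a; case: (boolP (satf _ _)) => sa; last by rewrite !mul0r.
rewrite !mul1r asl_prob_forced // (guess_prob_Some R hs _ _ e) (eq_guess_prob R hs _ (B := total_of a)) //.
by move=> y; rewrite !inE /update => /andP[/negPf ->].
Qed.

Lemma cost_Some F l : le_cnf k F -> (exists A, satf A F) -> sel F = Some l ->
  cost sel S (restrict_cnf F l) <= cost sel S F.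
Proof.
move=> lcF eF e; rewrite /cost [leRHS](big_fsetD1 l.1) ?(sel_in hs e) //=.
apply: le_trans (_ : \sum_(x <- vars F `\ l.1) var_cost sel S F x <= _).
  by apply: ler_sum => x _; exact: var_cost_Some.
by rewrite lerDr; apply: var_cost_ge0; exact: lcF.1.
Qed.

(** Double counting reduces this to one satisfying [A]. With p = p(F, A) and P the guessing
    probability of [x] in [F], the claim is sum w_y g_y <= P sum w_y - p. It holds since w_y >= p, P
    >= g_y and the differences P - g_y add up to 1. *)
Lemma var_cost_frozen_None F x : wf_cnf F -> (exists A, satf A F) -> sel F = None ->
  x \in vars F -> agree F x ->
  \sum_(l <- SL F) vc (restrict_cnf F l) x <= #|` SL F|%:R * vc F x - 1.
Proof.
move=> wF eF e xF h.
have -> : \sum_(l <- SL F) vc (restrict_cnf F l) x =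
   \sum_(l <- SL F) assignment_sum (vars F `\ l.1) (fun A => (satf A (restrict_cnf F l))%:R *
     (asl_prob R (restrict_cnf F l) A * guess_prob R sel (restrict_cnf F l) x A)).
  apply: eq_big_seq => l /(SLP _ wF)[lF _].
  have [xl|xl] := boolP (x \in vars (restrict_cnf F l)).
    by rewrite /vc var_cost_frozen //; [exact: wf_restrict | exact: agree_restrict].
  rewrite /vc var_cost_out // /assignment_sum big1 // => a _.
  by rewrite (guess_prob_notin R hs _ xl) !mulr0.
rewrite -(@assignment_sum_sat_split R F (fun l A => asl_prob R (restrict_cnf F l) A *
  guess_prob R sel (restrict_cnf F l) x A)) //; last first.
  move=> l A B AB; rewrite (eq_asl_prob R (F := restrict_cnf F l) AB).
  by rewrite (eq_guess_prob R hs (F := restrict_cnf F l) _ AB).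
rewrite /vc var_cost_frozen // -[X in _ - X](asl_prob_sum R wF eF) /assignment_sum mulr_sumr -sumrB.
apply: ler_sum => a _; case: (boolP (satf _ _)) => sa; last by rewrite !mul0r mulr0 subrr.
rewrite !mul1r; set A := total_of a in sa *.
pose w y := asl_prob R (restrict_cnf F (y, A y)) A.
pose g y := guess_prob R sel (restrict_cnf F (y, A y)) x A.
have Ew := asl_prob_rec R wF sa; have Eg := guess_prob_None R hs A e xF.
rewrite mulrA Ew -/(w _) mulr_suml -subr_ge0 addrAC -sumrB.
apply: le_trans (_ : \sum_(y <- vars F) (asl_prob R F A * (guess_prob R sel F x A - g y)) - asl_prob R F A <= _).
  by rewrite -mulr_sumr sumrB sumr_const_fset Eg addrK mulr1 subrr.
rewrite lerD2r !big_seq; apply: ler_sum => y yF; rewrite -/(w y) -/(g y) -mulrBr.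
rewrite ler_wpM2r ?asl_prob_le // subr_ge0.
exact: (@guess_prob_mono R _ _ hs F x A (y, A y)).
Qed.

(** Both literals over [x] are in [SL F] and bring its cost from [S] to 0; after any other literal
    it is at most [S]. *)
Lemma var_cost_free_None F x : le_cnf k F -> x \in vars F -> ~ agree F x ->
  \sum_(l <- SL F) vc (restrict_cnf F l) x <= #|` SL F|%:R * vc F x - 2 * S.
Proof.
move=> lcF xF h; have wF := lcF.1; rewrite [vc F x]var_cost_free //.
have xS b : (x, b) \in SL F.
  (* If no satisfying assignment took the value [b] at [x], all would take the other one and [x]
     would be frozen. *)
  apply/SLP => //; split=> //; apply: contrapT => hn; apply: h => A B sA sB.
  have : A x != b by apply/eqP => e; apply: hn; exists A.
  have : B x != b by apply/eqP => e; apply: hn; exists B.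
  by case: b (A x) (B x) {hn} => -[] [].
apply: le_trans (_ : \sum_(l <- SL F) (S - (l.1 == x)%:R * S) <= _).
  rewrite !big_seq; apply: ler_sum => l lS; have [lF [A sA Al]] := SLP _ wF lS.
  case: eqP => [lx|_]; last first.
    rewrite mul0r subr0; apply: var_cost_le; first exact: le_cnf_restrict.
    by exists A; exact: satf_restrict.
  by rewrite mul1r subrr /vc var_cost_out // !inE lx eqxx.
rewrite sumrB sumr_const_fset lerD2l lerN2.
rewrite SL_sum // (big_fsetD1 x) //= big_bool /= !xS eqxx mul1r.
rewrite -[leLHS]addr0 lerD //; first by rewrite mulrDl mul1r.
apply: sumr_ge0 => y _; apply: sumr_ge0 => b _; case: ifP => // _.
by rewrite mulr_ge0.
Qed.

Hypothesis hln : 2 * ln 2 * (1 - S) <= 1.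

Let free F x : R := if `[< agree F x >] then 0 else 1.

(** A frozen variable has one satisfiable literal, a non-frozen one has two. *)
Lemma card_SL F : wf_cnf F -> (exists A, satf A F) ->
  #|` SL F|%:R = \sum_(y <- vars F) (1 + free F y).
Proof.
move=> wF [A sA]; rewrite -(sum1_size (SL F)) natr_sum SL_sum //.
apply: eq_big_seq => y yF; rewrite /free big_bool /=.
have Ay : (y, A y) \in SL F by apply/SLP => //; split=> //; exists A.
case: asboolP => h.
  have : (y, ~~ A y) \notin SL F.
    by apply/(SLP _ wF) => -[_ [B sB /=]]; rewrite (h _ _ sB sA); case: (A y).
  by case: (A y) Ay => /= -> /negPf ->; rewrite ?addr0 ?add0r.
have yS b : (y, b) \in SL F.
  apply/SLP => //; split=> //; apply: contrapT => hn; apply: h => B C sB sC.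
  have : B y != b by apply/eqP => e; apply: hn; exists B.
  have : C y != b by apply/eqP => e; apply: hn; exists C.
  by case: b (B y) (C y) {hn} => -[] [].
by rewrite !yS.
Qed.

Lemma cost_None F : le_cnf k F -> (exists A, satf A F) -> sel F = None ->
  \sum_(l <- SL F) cost sel S (restrict_cnf F l) <=
  #|` SL F|%:R * cost sel S F - \sum_(y <- vars F) (1 + free F y * (2 * S - 1)).
Proof.
move=> lcF eF e; have wF := lcF.1; rewrite /cost mulr_sumr -sumrB.
(* The variable of [l] costs 0 in [F^[l]], so the inner sum may run over all of [vars F]. *)
have -> : \sum_(l <- SL F) \sum_(x <- vars (restrict_cnf F l)) var_cost sel S (restrict_cnf F l) x =
  \sum_(l <- SL F) \sum_(x <- vars F) vc (restrict_cnf F l) x.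
  apply: eq_big_seq => l /(SLP _ wF)[lF _]; rewrite [RHS](big_fsetD1 l.1) //=.
  by rewrite {1}/vc var_cost_out ?add0r //= !inE eqxx.
rewrite exchange_big /= !big_seq; apply: ler_sum => x xF; rewrite /free.
case: asboolP => h.
  by rewrite mul0r addr0; exact: var_cost_frozen_None.
rewrite (_ : 1 + 1 * (2 * S - 1) = 2 * S); last by ring.
exact: var_cost_free_None.
Qed.

Lemma solve_prob_ge F : le_cnf k F -> (exists A, satf A F) -> 2 `^ (- cost sel S F) <= solve_prob R sel F.
Proof.
elim/cnf_vars_ind: F => F IH lcF eF; have wF := lcF.1.
have [V0|V0] := eqVneq (vars F) fset0.
  by rewrite solve_prob_fset0 // /cost V0 big_seq_fset0 oppr0 powRr0.
case e: (sel F) => [l|].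
  have lF := sel_in hs e; rewrite (solve_prob_Some R hs e).
  have il : implied s F l by have := hs F; rewrite e.
  apply: le_trans (IH l lF (le_cnf_restrict _ lcF) _); last first.
    by case: eF => A sA; exists A; apply: satf_restrict => //; exact: implied_sat il sA.
  by rewrite ler_powR ?ler1n // lerN2 cost_Some.
set c := cost sel S F.
have n0 : (0 : R) < #|` vars F|%:R by rewrite ltr0n cardfs_gt0.
have psE := solve_prob_None R hs e V0.
(* The branches on literals outside [SL F] are bounded below by 0. *)
have h1 : \sum_(l <- SL F) solve_prob R sel (restrict_cnf F l) <= 2 * #|` vars F|%:R * solve_prob R sel F.
  rewrite psE SL_sum //; apply: ler_sum => y _; apply: ler_sum => b _.
  by case: ifP => // _; exact: solve_prob_ge0.
(* By induction each branch has at least 2^(-c_l) = 2^(-c) 2^(c - c_l), and the tangent bounds the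
   second factor. *)
have h2 : 2 `^ (- c) * (2 * \sum_(l <- SL F) (1 + (c - cost sel S (restrict_cnf F l) - 1) * ln 2))
    <= \sum_(l <- SL F) solve_prob R sel (restrict_cnf F l).
  rewrite !mulr_sumr !big_seq; apply: ler_sum => l /(SLP _ wF)[lF [A sA Al]].
  apply: le_trans (IH l lF (le_cnf_restrict _ lcF) _); last first.
    by exists A; exact: satf_restrict.
  apply: le_trans (_ : 2 `^ (- c) * 2 `^ (c - cost sel S (restrict_cnf F l)) <= _).
    by rewrite ler_wpM2l ?powR_ge0 ?powR2_tangent.
  by rewrite -powRD ?addKr // pnatr_eq0 implybT.
have h3 := cost_None lcF eF e; rewrite -/c in h3.
have N := card_SL wF eF.
have l2 : 0 <= ln (2 : R) by rewrite ln_ge0 // ler1n.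
have f0 : 0 <= \sum_(y <- vars F) free F y.
  by apply: sumr_ge0 => y _; rewrite /free; case: ifP.
set L := ln 2 in l2 h2 *; set Q := \sum_(l <- SL F) cost _ _ _ in h3.
set n : R := #|` vars F|%:R in n0 h1 *; pose M := \sum_(y <- vars F) free F y.
have EN : #|` SL F|%:R = n + M.
  by rewrite N big_split /= sumr_const_fset mulr1.
rewrite big_split /= sumr_const_fset mulr1 -mulr_suml -/M -/n EN in h3.
(* With N = n + M the sum is N + (N c - Q - N) L, and [h3] gives N c - Q - N >= M (2 S - 2). What
   remains is M (1 - 2 L (1 - S)) >= 0, from [hln]. *)
have h4 : n <= \sum_(l <- SL F) (1 + (c - cost sel S (restrict_cnf F l) - 1) * L).
  rewrite big_split /= -mulr_suml !sumrB !sumr_const_fset -/Q EN mulr1.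
  have a : M * (2 * S - 2) * L <= ((n + M) * c - Q - (n + M)) * L.
    by rewrite ler_wpM2r //; lra.
  have b : 0 <= M * (1 - 2 * L * (1 - S)) by rewrite mulr_ge0 // subr_ge0.
  lra.
have p0 := powR_ge0 (2 : R) (- c).
have h5 : 2 `^ (- c) * (2 * n) <= 2 * n * solve_prob R sel F.
  by apply: le_trans h1; apply: le_trans h2; rewrite ler_wpM2l // ler_pM2l.
by move: h5; rewrite mulrC ler_pM2l // mulr_gt0.
Qed.

End Main.

Theorem theorem5 (R : realType) (k s : nat) (sel : cnf -> option lit) (S : R)
    (F : cnf)
    (hk : (3 <= k)%N)
    (hsel : selection_rule s sel)
    (hSk : S_int R k <= S)
    (hS : forall F' : cnf, le_cnf k F' -> satisfiable F' ->
      forall x : vars F', frozen x ->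
      forall alpha : assignment (vars F'), alpha \in sat F' ->
      p_guessed R sel (val x) alpha <= S)
    (hF : le_cnf k F)
    (hFsat : satisfiable F) :
  2 `^ (- cost sel S F) <= p_success R sel F.
Proof.
have S7 : 7 / 24 <= S by apply: le_trans hSk; exact: S_int_ge.
have S0 : 0 <= S by lra.
have ln2 := @ln2_le R; have ln20 : 0 <= ln (2 : R) by rewrite ln_ge0 // ler1n.
apply: le_trans (p_success_ge hsel R hF.1); apply: (solve_prob_ge hsel hS S0) => //.
  (* The two constants fit exactly: 2 ln 2 (1 - S) <= 2 (12/17) (17/24) = 1. *)
  by nra.
by apply/satisfiableP => //; exact: hF.1.
Qed.
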